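(* There exists an irreducible and reduced surface $\mathcal{S} \subset \mathbf{P}^5$ and another scheme $\mathcal{S}'\subset\mathbf{P}^5$ supported on $\mathcal{S}$ which coincides with $\mathcal{S}$ outside one line and such that: 1) $\operatorname{reg}(\mathcal{S}') < \operatorname{reg}(\mathcal{S})$, 2) $\operatorname{depth}(R/I_{\mathcal{S}'}) > \operatorname{depth}(R/I_{\mathcal{S}})$.
   Context: $\mathbf{P}^5$ is projective 5-space over a field $k$, and $R = k[X_0,\ldots,X_5]$ is its homogeneous coordinate ring, with $\mathfrak m=(X_0,\ldots,X_5)$. For a closed subscheme $X\subset \mathbf{P}^5$, $I_X\subset R$ denotes its saturated homogeneous defining ideal, and $\operatorname{reg}(X)$ is the Castelnuovo-Mumford regularity of $X$, i.e. that of $R/I_X$ (using $I_X$ instead shifts it by one and does not affect the comparison). For a finitely generated graded $R$-module $M$, $\operatorname{reg}(M)=\max\{i+j : H^i_{\mathfrak m}(M)_j\neq 0\}$. Depth is with respect to $\mathfrak m$. ''Supported on $\mathcal{S}$'' means having the same underlying set as $\mathcal{S}$; ''coincides with $\mathcal{S}$ outside one line'' means that there is a line $\Lambda\subset\mathbf{P}^5$ such that $\mathcal{S}\setminus\Lambda$ and $\mathcal{S}'\setminus\Lambda$ are equal as subschemes of $\mathbf{P}^5\setminus\Lambda$. *)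

(* Defs.v *)
From HB Require Import structures.
From mathcomp Require Import all_boot all_order all_algebra.
From mathcomp Require Import fraction.
From mathcomp.multinomials Require Import mpoly.

Set Implicit Arguments.
Unset Strict Implicit.
Unset Printing Implicit Defensive.

Import GRing.Theory.
Local Open Scope ring_scope.

(** ** Homogeneous ideals of R = k[X_0, ..., X_n]                            *)

(* Ideals are Prop-valued predicates, so that no decidability is assumed
   where points of projective space are quantified over.                     *)
Record hideal (k : fieldType) (n : nat) := HIdeal {
  hideal_mem :> {mpoly k[n.+1]} -> Prop;
  hideal0 : hideal_mem 0;
  hidealD : forall f g, hideal_mem f -> hideal_mem g -> hideal_mem (f + g);
  hidealM : forall a f, hideal_mem f -> hideal_mem (a * f);
  hideal_homog : forall d f, hideal_mem f -> hideal_mem (pihomog mdeg d f)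
}.

(* A closed subscheme X of P^n is given by its saturated homogeneous ideal I_X;
   this is a bijection (Hartshorne, Exercise II.5.10).                       *)
Record closed_subscheme (k : fieldType) (n : nat) := ClosedSubscheme {
  defining_ideal :> hideal k n;
  saturated : forall f : {mpoly k[n.+1]},
    (forall i : 'I_n.+1, exists N : nat, defining_ideal ('X_i ^+ N * f)) ->
    defining_ideal f
}.

(** ** The topological space of P^n = Proj R                                 *)

Definition is_point (k : fieldType) (n : nat) (P : hideal k n) : Prop :=
  [/\ ~ P 1,
      forall f g, P (f * g) -> P f \/ P g
    & exists i : 'I_n.+1, ~ P 'X_i].

Definition V (k : fieldType) (n : nat) (A P : hideal k n) : Prop :=
  is_point P /\ forall f, A f -> P f.

Definition sub_points (k : fieldType) (n : nat) (Y Z : hideal k n -> Prop) :=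
  forall P, Y P -> Z P.

Definition irreducible_closed (k : fieldType) (n : nat) (A : hideal k n) :=
  (exists P, V A P) /\
  forall B C : hideal k n, sub_points (V A) (fun P => V B P \/ V C P) ->
    sub_points (V A) (V B) \/ sub_points (V A) (V C).

(* Z_0 < Z_1 < ... < Z_d, with Z_i = V (Z i) irreducible closed in V A.      *)
Definition irreducible_chain (k : fieldType) (n : nat) (A : hideal k n)
    (d : nat) (Z : nat -> hideal k n) : Prop :=
  (forall i, (i <= d)%N ->
     irreducible_closed (Z i) /\ sub_points (V (Z i)) (V A)) /\
  (forall i, (i < d)%N ->
     sub_points (V (Z i)) (V (Z i.+1)) /\ ~ sub_points (V (Z i.+1)) (V (Z i))).

Definition has_dim (k : fieldType) (n : nat) (A : hideal k n) (d : nat) :=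
  (exists Z, irreducible_chain A d Z) /\
  (forall e Z, irreducible_chain A e Z -> (e <= d)%N).

(** ** Scheme structure, through stalks inside Frac R                        *)

(* The stalk at P of the structure sheaf of P^n: fractions g / h with g and h
   homogeneous of the same degree and h outside P.                           *)
Definition local_ring (k : fieldType) (n : nat) (P : hideal k n)
    (u : {fraction {mpoly k[n.+1]}}) : Prop :=
  exists d (g h : {mpoly k[n.+1]}),
    [/\ g \is d.-homog, h \is d.-homog, ~ P h & u = tofrac g / tofrac h].

(* The stalk at P of the ideal sheaf of X.                                   *)
Definition ideal_stalk (k : fieldType) (n : nat) (I P : hideal k n)
    (u : {fraction {mpoly k[n.+1]}}) : Prop :=
  exists d (g h : {mpoly k[n.+1]}),
    [/\ g \is d.-homog /\ I g, h \is d.-homog, ~ P h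
      & u = tofrac g / tofrac h].

(* The local rings local_ring P / ideal_stalk X P of X have no nonzero
   nilpotents; they vanish at the points outside X.                          *)
Definition reduced (k : fieldType) (n : nat) (X : closed_subscheme k n) :=
  forall P, is_point P -> forall u m,
    local_ring P u -> ideal_stalk X P (u ^+ m) -> ideal_stalk X P u.

Definition same_support (k : fieldType) (n : nat) (X Y : closed_subscheme k n) :=
  forall P, V X P <-> V Y P.

(* The line cut out by the n - 1 linear forms given by the rows of L, which
   are required to be linearly independent where this is used.               *)
Definition on_line (k : fieldType) (n : nat) (L : 'M[k]_(n.-1, n.+1))
    (P : hideal k n) : Prop :=
  is_point P /\
  forall i, P (\sum_(j < n.+1) L i j *: ('X_j : {mpoly k[n.+1]})).

(* X \ L = Y \ L as subschemes of P^n \ L: the two ideal sheaves have the same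
   stalk at each point of P^n \ L.                                           *)
Definition coincide_outside_line (k : fieldType) (n : nat)
    (X Y : closed_subscheme k n) : Prop :=
  exists2 L : 'M[k]_(n.-1, n.+1), row_free L &
    forall P, is_point P -> ~ on_line L P ->
      forall u, ideal_stalk X P u <-> ideal_stalk Y P u.

(** ** Local cohomology of R/I and Castelnuovo-Mumford regularity            *)

Definition xprod (k : fieldType) (n : nat) (S : {set 'I_n.+1}) :
  {mpoly k[n.+1]} := \prod_(i in S) 'X_i.

(* The degree j part of R localized at xprod S, inside Frac R. As j is an
   integer, homogeneity of the numerator is read off its monomials, which
   makes 0 the only numerator of negative degree.                            *)
Definition loc_deg (k : fieldType) (n : nat) (S : {set 'I_n.+1}) (j : int)
    (u : {fraction {mpoly k[n.+1]}}) : Prop :=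
  exists N (f : {mpoly k[n.+1]}),
    {in msupp f, forall m, (mdeg m)%:Z = j + (N * #|S|)%:Z} /\
    u = tofrac f / tofrac (xprod k S) ^+ N.

(* The extension of I to R localized at xprod S.                             *)
Definition loc_ideal (k : fieldType) (n : nat) (I : hideal k n)
    (S : {set 'I_n.+1}) (u : {fraction {mpoly k[n.+1]}}) : Prop :=
  exists N (f : {mpoly k[n.+1]}),
    I f /\ u = tofrac f / tofrac (xprod k S) ^+ N.

Definition cech_diff (k : fieldType) (n : nat)
    (c : {set 'I_n.+1} -> {fraction {mpoly k[n.+1]}}) (T : {set 'I_n.+1}) :
    {fraction {mpoly k[n.+1]}} :=
  \sum_(t in T) (-1) ^+ #|[set s in T | (s < t)%N]| * c (T :\ t).

(* H^i_m(R/I)_j <> 0, computed by the Cech complex of R/I on X_0, ..., X_n: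
   in cohomological degree i it is the sum, over the sets S of cardinal i, of
   the localizations of R/I at xprod S. A cochain is represented by lifts to
   the localizations of R, so its vanishing is membership in loc_ideal I.    *)
Definition local_cohomology_neq0 (k : fieldType) (n : nat) (I : hideal k n)
    (i : nat) (j : int) : Prop :=
  exists c : {set 'I_n.+1} -> {fraction {mpoly k[n.+1]}},
    [/\ forall S : {set 'I_n.+1}, #|S| = i -> loc_deg S j (c S),
        forall T : {set 'I_n.+1}, #|T| = i.+1 -> loc_ideal I T (cech_diff c T)
      & ~ exists b : {set 'I_n.+1} -> {fraction {mpoly k[n.+1]}},
          (forall U : {set 'I_n.+1}, #|U|.+1 = i -> loc_deg U j (b U)) /\
          (forall S : {set 'I_n.+1}, #|S| = i ->
             loc_ideal I S (c S - cech_diff b S))].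

(* reg(R/I) = r.                                                             *)
Definition is_reg (k : fieldType) (n : nat) (I : hideal k n) (r : int) : Prop :=
  (exists i j, local_cohomology_neq0 I i j /\ i%:Z + j = r) /\
  (forall i j, local_cohomology_neq0 I i j -> i%:Z + j <= r).

(** ** Depth of R/I with respect to (X_0, ..., X_n)                          *)

Definition max_ideal (k : fieldType) (n : nat) (f : {mpoly k[n.+1]}) : Prop :=
  exists a : 'I_n.+1 -> {mpoly k[n.+1]}, f = \sum_i a i * 'X_i.

(* s is an (R/J)-regular sequence of elements of (X_0, ..., X_n); J need not be
   homogeneous, and grows by the first element of s at each step.            *)
Fixpoint regular_seq (k : fieldType) (n : nat) (J : {mpoly k[n.+1]} -> Prop)
    (s : seq {mpoly k[n.+1]}) : Prop :=
  match s with
  | [::] => ~ J 1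
  | f :: s' =>
      [/\ max_ideal f,
          forall g, J (f * g) -> J g
        & regular_seq (fun g => exists a, J (g - a * f)) s']
  end.

Definition is_depth (k : fieldType) (n : nat) (I : hideal k n) (d : nat) :=
  (exists s, regular_seq I s /\ size s = d) /\
  (forall s, regular_seq I s -> (size s <= d)%N).

(* Main.v *)
(* S is the toric surface with coordinate ring A = k[u, u t, v, v t^2, v t^6, v t^8],
   the variables being x, y, z0, z1, z2, z3. Its ideal needs the quintic
   F = y^4 z1 - x^4 z2, and S' is defined by the subideal J of the f whose class
   along the line z0 = ... = z3 = 0 does not involve F: J is the kernel of the
   same monomial map in which the two terms of F, and of their multiples by
   monomials in x and y, are kept apart. Then z_i F lies in J, so I_S / J is the
   k[x, y]-module generated by F, supported on that line.

   The monomial g = u^2 v t^5 is not in A but every variable multiplies it into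
   A; this gives H^1(A)_3 <> 0, hence depth A = 1 and reg A >= 4. In R/J the two
   expressions x (y g) and y (x g) of x y g are distinct, and x, y - z0 becomes a
   regular sequence. Multiplication by u v t^5 gives a nonzero class in
   Ext^2(k, R/J), so the depth of R/J is exactly 2.

   For the regularity, if h is a linear form and the multiplication by h on R/I
   is injective in degrees > r, then the vanishing of H^i(R/I + (h))_j for
   i + j > r implies that of H^i(R/I)_j. With h = x, y - z0, z3 this reduces the
   bounds reg R/J <= 3 and reg A <= 4 to statements on residue classes of
   monomials. *)

Require Import Defs.
From HB Require Import structures.
From mathcomp Require Import all_boot all_order all_algebra.
From mathcomp Require Import bigenough fraction ring zify.
From mathcomp.multinomials Require Import ssrcomplements mpoly.
From Stdlib Require Import Classical.

Set Implicit Arguments.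
Unset Strict Implicit.
Unset Printing Implicit Defensive.

Import Order.TTheory GRing.Theory Num.Theory BigEnough.
Local Open Scope ring_scope.

(** * Ideals spanned by monomials and differences of monomials *)

Section CoefSum.
Context (k : fieldType) (n : nat).
Implicit Types (f g : {mpoly k[n]}) (m e : 'X_{1..n}) (P Q : pred 'X_{1..n}).

Definition coefsum P f : k := \sum_(m <- msupp f | P m) f@_m.

Lemma coefsumwE P f i : (msize f <= i)%N ->
  coefsum P f = \sum_(m : 'X_{1..n < i} | P m) f@_m.
Proof.
move=> lt_fi; pose I : subFinType _ := 'X_{1..n < i}.
rewrite /coefsum (big_mksub_cond I) //=; first last.
- by move=> x /msize_mdeg_lt /leq_trans /(_ lt_fi) ->.
- by rewrite msupp_uniq.
rewrite -big_filter_cond big_rmcond ?big_filter //=.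
by move=> m /memN_msupp_eq0 ->.
Qed.

Lemma coefsum_is_linear P : scalar (coefsum P).
Proof.
move=> c f g /=; pose_big_enough i.
  rewrite !(@coefsumwE P _ i) //.
  rewrite mulr_sumr -big_split /=; apply: eq_bigr => m _.
  by rewrite mcoeffD mcoeffZ.
by close.
Qed.

HB.instance Definition _ P :=
  GRing.isLinear.Build k {mpoly k[n]} k *%R (coefsum P) (coefsum_is_linear P).

Lemma coefsumX P m : coefsum P 'X_[m] = (P m)%:R.
Proof.
rewrite /coefsum msuppX big_mkcond big_seq1 mcoeffX eqxx.
by case: (P m).
Qed.

Lemma coefsumMX P e f :
  coefsum P ('X_[e] * f) = coefsum (fun m => P (e + m)%MM) f.
Proof.
rewrite [f]mpolyE mulr_sumr !linear_sum /=; apply: eq_bigr => m _.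
by rewrite -scalerAr !linearZ /= -mpolyXD !coefsumX.
Qed.

Lemma eq_coefsum P Q f :
  {in msupp f, P =1 Q} -> coefsum P f = coefsum Q f.
Proof.
move=> PQ; rewrite /coefsum big_seq_cond [RHS]big_seq_cond.
by apply: eq_bigl => m; case: (boolP (m \in msupp f)) => //= /PQ ->.
Qed.

Lemma coefsum0P P f : {in msupp f, forall m, ~~ P m} -> coefsum P f = 0.
Proof.
move=> H; rewrite (@eq_coefsum _ pred0) => [|m /H /negbTE //].
by rewrite /coefsum big_pred0.
Qed.

Lemma coefsumMX0 P e f :
  (forall m, ~~ P (e + m)%MM) -> coefsum P ('X_[e] * f) = 0.
Proof. by move=> H; rewrite coefsumMX coefsum0P. Qed.

Section Congruence.
Context (T : eqType) (kap : 'X_{1..n} -> option T).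

(* The span of the monomials of class [None] and of the differences of
   monomials of equal class: the kernel of the map to the vector space with
   basis [T]. *)
Definition cong f : Prop := forall c, coefsum (fun m => kap m == Some c) f = 0.

Lemma congB f g : cong f -> cong g -> cong (f - g).
Proof. by move=> Hf Hg c; rewrite linearB /= Hf Hg subr0. Qed.

Lemma congD f g : cong f -> cong g -> cong (f + g).
Proof. by move=> Hf Hg c; rewrite linearD /= Hf Hg addr0. Qed.

Lemma congZ a f : cong f -> cong (a *: f).
Proof. by move=> Hf c; rewrite linearZ /= Hf mulr0. Qed.

Lemma cong0 : cong 0.
Proof. by move=> c; rewrite linear0. Qed.

Lemma congX m : kap m = None -> cong 'X_[m].
Proof. by move=> H c; rewrite coefsumX H. Qed.

Lemma congXB m m' : kap m = kap m' -> cong ('X_[m] - 'X_[m']).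
Proof. by move=> H c; rewrite linearB /= !coefsumX H subrr. Qed.

(** Induction on the size of the support. A monomial [m] of [f] is removed if its class is [None],
    or traded for another monomial of its class in the support; in both cases the support
    shrinks. *)
Lemma cong_sub (J : {mpoly k[n]} -> Prop) :
  J 0 -> (forall f g, J f -> J g -> J (f + g)) ->
  (forall a f, J f -> J (a *: f)) ->
  (forall m, kap m = None -> J 'X_[m]) ->
  (forall m m' c, kap m = Some c -> kap m' = Some c -> J ('X_[m] - 'X_[m'])) ->
  forall f, cong f -> J f.
Proof.
move=> J0 JD JZ JX JXB f; have [s] := ubnP (size (msupp f)).
elim: s f => // s IH f lt_s cf.
case Ef : (msupp f) => [|m r]; first by rewrite (msuppnil0 Ef).
have mf : m \in msupp f by rewrite Ef mem_head.
have drop h : (forall m', m' \in msupp h -> m' \in msupp f) ->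
    cong h -> m \notin msupp h -> J h.
  move=> sub ch mh; apply: IH => //; move: lt_s; rewrite Ef /= !ltnS.
  apply/leq_ltn_trans/uniq_leq_size; first exact: msupp_uniq.
  move=> m' mh'; have := sub _ mh'; rewrite Ef inE => /orP[/eqP E|//].
  by rewrite -E mh' in mh.
case Em : (kap m) => [c|]; last first.
  rewrite -[f](subrK (f@_m *: 'X_[m])); apply: JD; last by apply/JZ/JX.
  apply: drop; last by rewrite (perm_mem (msupp_rem f m)) mem_rem_uniqF ?msupp_uniq.
    by move=> m'; rewrite (perm_mem (msupp_rem f m)) => /mem_rem.
  by apply/congB/congZ/congX.
have [/hasP[m' m'f /andP[/eqP km' nm']]|H] :=
  boolP (has (fun m' => (kap m' == Some c) && (m' != m)) (msupp f)).
  set g := f@_m *: ('X_[m] - 'X_[m']).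
  rewrite -[f](subrK g); apply: JD; last by apply/JZ/(JXB _ _ c).
  have gE m'' : (f - g)@_m'' =
      f@_m'' - f@_m * ((m == m'')%:R - (m' == m'')%:R).
    by rewrite mcoeffB mcoeffZ mcoeffB !mcoeffX.
  apply: drop; last by rewrite -mcoeff_eq0 gE eqxx (negbTE nm') subr0 mulr1 subrr.
    move=> m''; rewrite !mcoeff_msupp gE.
    case: (eqVneq m m'') => [<-|_]; first by rewrite -mcoeff_msupp mf.
    case: (eqVneq m' m'') => [<-|_]; first by rewrite -mcoeff_msupp m'f.
    by rewrite subrr mulr0 subr0.
  by apply/congB/congZ/congXB => //; rewrite Em km'.
(* Now [m] is alone in its class, so its coefficient is the class sum, which is zero. *)
suff : f@_m = 0 by move/eqP; rewrite mcoeff_eq0 mf.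
have := cf c; rewrite /coefsum big_mkcond (bigD1_seq m) ?msupp_uniq //=.
rewrite Em eqxx big_seq_cond big1 ?addr0 // => m' /andP[m'f nm'].
case: eqP => // km'; case/hasP: H; exists m' => //.
by rewrite km' eqxx.
Qed.

End Congruence.
End CoefSum.

Section CongIdeal.
Context (k : fieldType) (n : nat) (T : eqType) (kap : 'X_{1..n.+1} -> option T).
Hypothesis kap_add : forall e m m', kap m = kap m' -> kap (e + m)%MM = kap (e + m')%MM.
Hypothesis kap_none : forall e m, kap m = None -> kap (e + m)%MM = None.
Hypothesis kap_deg : forall m m' c,
  kap m = Some c -> kap m' = Some c -> mdeg m = mdeg m'.

Lemma cong_mulX e (f : {mpoly k[n.+1]}) : cong kap f -> cong kap ('X_[e] * f).
Proof.
apply: (cong_sub (J := fun f => cong kap ('X_[e] * f))).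
- by rewrite mulr0; apply: cong0.
- by move=> g h ? ?; rewrite mulrDr; apply: congD.
- by move=> a g ?; rewrite -scalerAr; apply: congZ.
- by move=> m Hm; rewrite -mpolyXD; apply/congX/kap_none.
- move=> m m' c Hm Hm'; rewrite mulrBr -!mpolyXD; apply/congXB/kap_add.
  by rewrite Hm Hm'.
Qed.

Lemma cong_mul (a f : {mpoly k[n.+1]}) : cong kap f -> cong kap (a * f).
Proof.
move=> cf; rewrite [a]mpolyE mulr_suml.
elim/big_ind: _ => [|g h|m _]; [exact: cong0|exact: congD|].
by rewrite -scalerAl; apply/congZ/cong_mulX.
Qed.

Lemma cong_pihomog d (f : {mpoly k[n.+1]}) : cong kap f -> cong kap (pihomog mdeg d f).
Proof.
apply: (cong_sub (J := fun f => cong kap (pihomog mdeg d f))).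
- by rewrite linear0; apply: cong0.
- by move=> g h ? ?; rewrite linearD /=; apply: congD.
- by move=> a g ?; rewrite linearZ /=; apply: congZ.
- move=> m Hm; rewrite pihomogX; case: ifP => _; [exact: congX|exact: cong0].
- move=> m m' c Hm Hm'; rewrite linearB /= !pihomogX /= (kap_deg Hm Hm').
  case: ifP => _; last by rewrite subrr; apply: cong0.
  by apply/congXB; rewrite Hm Hm'.
Qed.

Definition cong_hideal : hideal k n :=
  HIdeal (@cong0 k _ T kap) (@congD k _ T kap) cong_mul cong_pihomog.

End CongIdeal.

(** * Vanishing of local cohomology and hyperplane sections *)

Lemma fin_uniform_bound (I : finType) (Q : I -> nat -> Prop) :
  (forall i, exists N, forall M, (N <= M)%N -> Q i M) ->
  exists N, forall i M, (N <= M)%N -> Q i M.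
Proof.
case/fin_all_exists=> f Hf; exists (\max_i f i)%N => i M le_NM.
by apply/Hf/(leq_trans _ le_NM)/leq_bigmax.
Qed.

Lemma mulrA_divl_cancel (K : fieldType) (a b d : K) : a != 0 -> a * (b / (a * d)) = b / d.
Proof. by move=> a0; rewrite invfM mulrCA mulVKf. Qed.

Lemma tofrac_div_inj (D : idomainType) (a b c d : D) (N M : nat) :
  tofrac c ^+ N != 0 -> tofrac d ^+ M != 0 ->
  tofrac a / tofrac c ^+ N = tofrac b / tofrac d ^+ M -> a * d ^+ M = b * c ^+ N.
Proof.
move=> c0 d0 /eqP; rewrite eqr_div // -!rmorphXn -!rmorphM tofrac_eq.
by move/eqP.
Qed.

Section Cech.
Context (k : fieldType) (n : nat).
Local Notation R := {mpoly k[n.+1]}.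
Local Notation F := {fraction R}.
Local Notation st := {set 'I_n.+1}.
Implicit Types (I J : hideal k n) (S T U : st) (f g h : R) (u v : F) (i N M : nat)
  (j r D : int) (b c : st -> F).

Definition zhomog D f := {in msupp f, forall m, (mdeg m)%:Z = D}.

Lemma zhomogD D f g : zhomog D f -> zhomog D g -> zhomog D (f + g).
Proof.
by move=> Hf Hg m /msuppD_le; rewrite mem_cat => /orP[/Hf|/Hg].
Qed.

Lemma zhomogM D D' f g : zhomog D f -> zhomog D' g -> zhomog (D + D') (f * g).
Proof.
move=> Hf Hg m /msuppM_le/allpairsP[[m1 m2] /= [/Hf <- /Hg <- ->]].
by rewrite mdegD PoszD.
Qed.

Lemma zhomogN D f : zhomog D f -> zhomog D (- f).
Proof. by move=> Hf m; rewrite (perm_mem (msuppN f)) => /Hf. Qed.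

Lemma zhomog0 D : zhomog D 0.
Proof. by move=> m; rewrite msupp0. Qed.

Lemma zhomogP (d : nat) f : f \is d.-homog <-> zhomog d f.
Proof.
split=> [/dhomogP H m /H <- //|H]; apply/dhomogP => m /H.
by case.
Qed.

Lemma zhomogX i j f : zhomog j f -> zhomog (j * i%:Z) (f ^+ i).
Proof.
move=> Hf; elim: i => [|i IH].
  by rewrite expr0 mulr0; apply/(zhomogP 0)/dhomog1.
by rewrite exprS -addn1 addnC PoszD mulrDr mulr1; apply: zhomogM.
Qed.

Lemma zhomog_xprod S : zhomog (#|S|)%:Z (xprod k S).
Proof.
rewrite /xprod -sum1_card; apply/zhomogP.
elim/big_rec2: _ => [|t f d _ IH]; first exact: dhomog1.
by apply: dhomogM => //; rewrite dhomogX /= mdeg1.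
Qed.

Lemma xprod_neq0 S : tofrac (xprod k S) != 0.
Proof.
rewrite tofrac_eq0; apply/prodf_neq0 => t _.
by rewrite -msize_poly_eq0 msizeX.
Qed.

Lemma xprodX_neq0 S N : tofrac (xprod k S) ^+ N != 0.
Proof. by rewrite expf_neq0 ?xprod_neq0. Qed.

Lemma xprodD1 S t : t \in S -> xprod k S = 'X_t * xprod k (S :\ t).
Proof. by move=> tS; rewrite /xprod (big_setD1 t). Qed.

Lemma frac_cancel S g f N : tofrac (xprod k S ^+ N * f) / tofrac (xprod k S * g) ^+ N =
  tofrac f / tofrac g ^+ N.
Proof.
by rewrite rmorphM rmorphXn rmorphM exprMn -mulf_div divff ?mul1r ?xprodX_neq0.
Qed.

Lemma frac_shift S f N M : tofrac (xprod k S ^+ N * f) / tofrac (xprod k S) ^+ (N + M) =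
  tofrac f / tofrac (xprod k S) ^+ M.
Proof.
by rewrite exprD rmorphM rmorphXn -mulf_div divff ?mul1r ?xprodX_neq0.
Qed.

Lemma loc_degP S j u : loc_deg S j u ->
  exists N, forall M, (N <= M)%N -> exists f,
    zhomog (j + (M * #|S|)%:Z) f /\ u = tofrac f / tofrac (xprod k S) ^+ M.
Proof.
case=> N [f [Hf ->]]; exists N => M le_NM; exists (xprod k S ^+ (M - N) * f).
split.
  have -> : j + (M * #|S|)%:Z = #|S|%:Z * (M - N)%:Z + (j + (N * #|S|)%:Z).
    by rewrite -{1}(subnK le_NM); lia.
  by apply: zhomogM => //; apply/zhomogX/zhomog_xprod.
by rewrite -{2}(subnK le_NM) frac_shift.
Qed.

Lemma loc_idealP I S u : loc_ideal I S u ->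
  exists N, forall M, (N <= M)%N -> exists f,
    I f /\ u = tofrac f / tofrac (xprod k S) ^+ M.
Proof.
case=> N [f [Hf ->]]; exists N => M le_NM; exists (xprod k S ^+ (M - N) * f).
split; first exact: hidealM.
by rewrite -{2}(subnK le_NM) frac_shift.
Qed.

Lemma loc_degD S j u v : loc_deg S j u -> loc_deg S j v -> loc_deg S j (u + v).
Proof.
move=> /loc_degP[N Hu] /loc_degP[N' Hv].
have [f [Hf ->]] := Hu _ (leq_maxl N N'); have [g [Hg ->]] := Hv _ (leq_maxr N N').
exists (maxn N N'), (f + g); split; first exact: zhomogD.
by rewrite rmorphD mulrDl.
Qed.

Lemma loc_deg0 S j : loc_deg S j (0 : F).
Proof. by exists 0%N, 0; rewrite rmorph0 mul0r; split=> //; apply: zhomog0. Qed.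

Lemma loc_degM S j D f u : zhomog D f -> loc_deg S j u -> loc_deg S (j + D) (tofrac f * u).
Proof.
move=> Hf [N [g [Hg ->]]]; exists N, (f * g); split; last by rewrite rmorphM mulrA.
by rewrite addrAC addrC; apply: zhomogM.
Qed.

Lemma loc_degN S j u : loc_deg S j u -> loc_deg S j (- u).
Proof.
case=> N [g [Hg ->]]; exists N, (- g); split; first exact: zhomogN.
by rewrite rmorphN mulNr.
Qed.

Lemma loc_deg_sign S j u i : loc_deg S j u -> loc_deg S j ((-1) ^+ i * u).
Proof.
by rewrite -signr_odd; case: odd => ?; rewrite ?mulN1r ?mul1r //; apply: loc_degN.
Qed.

Lemma loc_degW S T j u : S \subset T -> loc_deg S j u -> loc_deg T j u.
Proof.
move=> sST [N [f [Hf ->]]].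
have ET : xprod k T = xprod k (T :\: S) * xprod k S.
  rewrite /xprod mulrC (big_setID S) /=; congr (_ * _).
  by apply: eq_bigl => t; rewrite inE andb_idl // => /(subsetP sST).
exists N, (xprod k (T :\: S) ^+ N * f); split.
  have -> : j + (N * #|T|)%:Z = #|T :\: S|%:Z * N%:Z + (j + (N * #|S|)%:Z).
    have := cardsID S T; rewrite (setIidPr sST); nia.
  by apply: zhomogM => //; apply/zhomogX/zhomog_xprod.
by rewrite ET frac_cancel.
Qed.

Lemma loc_idealW I S T u : S \subset T -> loc_ideal I S u -> loc_ideal I T u.
Proof.
move=> sST [N [f [Hf ->]]].
have ET : xprod k T = xprod k (T :\: S) * xprod k S.
  rewrite /xprod mulrC (big_setID S) /=; congr (_ * _).
  by apply: eq_bigl => t; rewrite inE andb_idl // => /(subsetP sST).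
exists N, (xprod k (T :\: S) ^+ N * f); split; first exact: hidealM.
by rewrite ET frac_cancel.
Qed.

Lemma loc_idealD I S u v : loc_ideal I S u -> loc_ideal I S v -> loc_ideal I S (u + v).
Proof.
move=> /loc_idealP[N Hu] /loc_idealP[N' Hv].
have [f [Hf ->]] := Hu _ (leq_maxl N N'); have [g [Hg ->]] := Hv _ (leq_maxr N N').
exists (maxn N N'), (f + g); split; first exact: hidealD.
by rewrite rmorphD mulrDl.
Qed.

Lemma loc_idealM I S f u : loc_ideal I S u -> loc_ideal I S (tofrac f * u).
Proof.
case=> N [g [Hg ->]]; exists N, (f * g); split; first exact: hidealM.
by rewrite rmorphM mulrA.
Qed.

Lemma loc_ideal0 I S : loc_ideal I S (0 : F).
Proof. by exists 0%N, 0; rewrite rmorph0 mul0r; split=> //; apply: hideal0. Qed.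

Lemma loc_ideal_sign I S u i : loc_ideal I S u -> loc_ideal I S ((-1) ^+ i * u).
Proof.
move=> Hu; have := loc_idealM ((-1) ^+ i) Hu.
by rewrite rmorphXn rmorphN1.
Qed.

Lemma loc_idealN I S u : loc_ideal I S u -> loc_ideal I S (- u).
Proof. by move/(loc_ideal_sign 1); rewrite expr1 mulN1r. Qed.

Lemma loc_idealB I S u v : loc_ideal I S u -> loc_ideal I S v -> loc_ideal I S (u - v).
Proof. by move=> Hu Hv; apply/loc_idealD/loc_idealN. Qed.

Lemma loc_ideal_sub I J S u : (forall f, I f -> J f) -> loc_ideal I S u -> loc_ideal J S u.
Proof. by move=> H [N [f [Hf ->]]]; exists N, f; split=> //; apply: H. Qed.

Lemma cech_diffD b c T :
  cech_diff (fun S => b S + c S) T = cech_diff b T + cech_diff c T.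
Proof. by rewrite /cech_diff -big_split; apply: eq_bigr => t _; rewrite mulrDr. Qed.

Lemma cech_diffM u c T : cech_diff (fun S => u * c S) T = u * cech_diff c T.
Proof. by rewrite /cech_diff mulr_sumr; apply: eq_bigr => t _; rewrite mulrCA. Qed.

Lemma card_below_D1 T (s t : 'I_n.+1) :
  #|[set r in T | (r < s)%N]| =
  (((t \in T) && (t < s)%N) + #|[set r in T :\ t | (r < s)%N]|)%N.
Proof.
rewrite (cardsD1 t) inE; congr (_ + _)%N; apply: eq_card => r.
by rewrite !inE andbA.
Qed.

(** The terms for [(t, s)] and [(s, t)] cancel: deleting the smaller index first changes the sign
    attached to the larger one, while deleting the larger first leaves the sign of the smaller
    one. *)
Lemma cech_diffK c T : cech_diff (cech_diff c) T = 0.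
Proof.
pose sg S (t : 'I_n.+1) : F := (-1) ^+ #|[set s in S | (s < t)%N]|.
pose G t s := sg T t * sg (T :\ t) s * c (T :\ t :\ s).
have GA (t s : 'I_n.+1) : t \in T -> s \in T -> (t < s)%N -> G s t = - G t s.
  move=> tT sT lt_ts; rewrite /G setDDl setUC -setDDl -!mulNr; congr (_ * _).
  rewrite /sg (card_below_D1 T s t) tT lt_ts (card_below_D1 T t s) sT.
  rewrite ltnNge (ltnW lt_ts) /= add0n exprS; ring.
have -> : cech_diff (cech_diff c) T =
    \sum_t \sum_s (if (t \in T) && (s \in T) && (t < s)%N then G t s else 0) +
    \sum_t \sum_s (if (t \in T) && (s \in T) && (s < t)%N then G t s else 0).
  rewrite /cech_diff big_mkcond -big_split; apply: eq_bigr => t _ /=.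
  case: ifP => tT; last first.
    by rewrite !big1 ?addr0 // => s _; rewrite ?andbF ?tT.
  rewrite mulr_sumr -big_split big_mkcond; apply: eq_bigr => s _ /=.
  rewrite !inE; case: (boolP (s \in T)) => sT; rewrite ?andbF ?addr0 //= andbT.
  by case: (ltngtP s t) => [lt|lt|/val_inj ->]; rewrite ?eqxx ?addr0 ?add0r ?mulrA //;
    rewrite (_ : s != t) // neq_ltn lt ?orbT.
rewrite [X in _ + X]exchange_big -big_split big1 // => t _ /=.
rewrite -big_split big1 // => s _ /=.
rewrite [(s \in T) && _]andbC.
by case: ifP => [/andP[/andP[tT sT] lt]|_]; rewrite ?addr0 // (GA t s) ?subrr.
Qed.

Definition cocycle I i j c : Prop :=
  (forall S, #|S| = i -> loc_deg S j (c S)) /\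
  (forall T, #|T| = i.+1 -> loc_ideal I T (cech_diff c T)).

Definition coboundary I i j c : Prop :=
  exists b, (forall U, #|U|.+1 = i -> loc_deg U j (b U)) /\
    (forall S, #|S| = i -> loc_ideal I S (c S - cech_diff b S)).

Lemma local_cohomology_neq0P I i j : local_cohomology_neq0 I i j <->
  exists2 c, cocycle I i j c & ~ coboundary I i j c.
Proof. by split=> [[c [? ? ?]]|[c [? ?] ?]]; exists c. Qed.

Lemma cocycleM I i j c D f :
  zhomog D f -> cocycle I i j c -> cocycle I i (j + D) (fun S => tofrac f * c S).
Proof.
move=> Hf [Hc Hd]; split=> [S /Hc|T /Hd HT]; first exact: loc_degM.
by rewrite cech_diffM; apply: loc_idealM.
Qed.

Lemma coboundaryD I i j b c :
  coboundary I i j b -> coboundary I i j c -> coboundary I i j (fun S => b S + c S).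
Proof.
move=> [a [Ha Hb]] [a' [Ha' Hc]]; exists (fun U => a U + a' U); split=> [U HU|S HS].
  by apply: loc_degD; auto.
rewrite cech_diffD opprD addrACA; apply: loc_idealD; auto.
Qed.

Lemma coboundaryM I i j c D f : zhomog D f ->
  coboundary I i j c -> coboundary I i (j + D) (fun S => tofrac f * c S).
Proof.
move=> Hf [a [Ha Hb]]; exists (fun U => tofrac f * a U); split=> [U /Ha|S /Hb HS].
  exact: loc_degM.
by rewrite cech_diffM -mulrBr; apply: loc_idealM.
Qed.

Lemma eq_coboundary I i j b c : b =1 c -> coboundary I i j b -> coboundary I i j c.
Proof. by move=> E [a [Ha Hb]]; exists a; split=> // S /Hb; rewrite E. Qed.

Lemma coboundary0 I i j : coboundary I i j (fun=> 0).
Proof.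
exists (fun=> 0); split=> [U _|S _]; first exact: loc_deg0.
rewrite (_ : cech_diff _ _ = 0) ?subr0; first exact: loc_ideal0.
by rewrite /cech_diff big1 // => t _; rewrite mulr0.
Qed.

(** * Powers of a variable kill local cohomology classes *)

Section Torsion.
Variables (I : hideal k n) (i : nat) (j : int) (c : st -> F) (t : 'I_n.+1).
Hypothesis Hc : cocycle I i j c.

Local Notation sgt S := ((-1) ^+ #|[set s in S | (s < t)%N]| : F).
Local Notation Xt := (tofrac ('X_t : R)).

(** The contraction of the Cech complex that exists once ['X_t] is inverted, times a power of ['X_t]
    meant to clear this variable from the denominator of [c (t |: U)]. *)
Let homotopy M U : F := if t \in U then 0 else sgt U * (Xt ^+ M * c (t |: U)).

Lemma homotopy_deg : exists N, forall M, (N <= M)%N ->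
  forall U, #|U|.+1 = i -> loc_deg U (j + M%:Z) (homotopy M U).
Proof.
have [U|N HN] := @fin_uniform_bound st (fun U M => #|U|.+1 = i ->
    loc_deg U (j + M%:Z) (homotopy M U)); last by exists N => M le_NM U; apply: HN.
have [tU|tU] := boolP (t \in U).
  by exists 0%N => M _ _; rewrite /homotopy tU; apply: loc_deg0.
have [HU|HU] := eqVneq #|U|.+1 i; last first.
  by exists 0%N => M _ E; rewrite E eqxx in HU.
have Et : #|t |: U| = i by rewrite cardsU1 tU.
have [N [f [Hf Ec]]] := Hc.1 _ Et.
exists N => M le_NM _; rewrite /homotopy (negbTE tU) Ec; apply: loc_deg_sign.
exists N, ('X_t ^+ (M - N) * f); split.
  have -> : j + M%:Z + (N * #|U|)%:Z = 1%:Z * (M - N)%:Z + (j + (N * #|t |: U|)%:Z).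
    by rewrite Et -HU; lia.
  apply: zhomogM => //; apply: (@zhomogX _ 1).
  by apply/(zhomogP 1); rewrite dhomogX /= mdeg1.
rewrite (xprodD1 (setU11 t U)) setU1K //.
have Xt0 : Xt != 0 by rewrite tofrac_eq0 -msize_poly_eq0 msizeX.
rewrite -{1}(subnK le_NM) exprD !rmorphM exprMn !rmorphXn /=.
by rewrite -[LHS]mulrA mulrA_divl_cancel ?expf_neq0 // mulrA.
Qed.

Lemma torsion_diff : exists N, forall M, (N <= M)%N ->
  forall T, #|T| = i.+1 -> t \in T -> loc_ideal I (T :\ t) (Xt ^+ M * cech_diff c T).
Proof.
have [T|N HN] := @fin_uniform_bound st (fun T M => #|T| = i.+1 -> t \in T ->
    loc_ideal I (T :\ t) (Xt ^+ M * cech_diff c T)); last by exists N => M le_NM T; apply: HN.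
have [HT|HT] := eqVneq #|T| i.+1; last first.
  by exists 0%N => M _ E; rewrite E eqxx in HT.
have [N [f [Hf ->]]] := Hc.2 _ HT.
exists N => M le_NM _ tT; exists N, ('X_t ^+ (M - N) * f); split; first exact: hidealM.
rewrite (xprodD1 tT).
have Xt0 : Xt != 0 by rewrite tofrac_eq0 -msize_poly_eq0 msizeX.
rewrite -{1}(subnK le_NM) exprD !rmorphM exprMn !rmorphXn /=.
by rewrite -[LHS]mulrA mulrA_divl_cancel ?expf_neq0 // mulrA.
Qed.

(** The homotopy formula: what is left over is the contraction of [cech_diff c], which the cocycle
    condition puts in the localized ideal for large [M]. *)
Lemma homotopyE M S : #|S| = i ->
  Xt ^+ M * c S - cech_diff (homotopy M) S =
  if t \in S then 0 else sgt S * (Xt ^+ M * cech_diff c (t |: S)).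
Proof.
move=> HS; have [tS|tS] := boolP (t \in S).
  rewrite /cech_diff (big_setD1 t) //= big1 ?addr0 => [|s]; last first.
    rewrite !inE => /andP[st sS]; rewrite /homotopy !inE eq_sym st tS.
    by rewrite mulr0.
  rewrite /homotopy !inE eqxx /= setD1K // mulrA.
  by rewrite (card_below_D1 S t t) ltnn andbF add0n -expr2 sqrr_sign mul1r subrr.
have tT : t \in t |: S by exact: setU11.
have TS : (t |: S) :\ t = S by rewrite setU1K.
rewrite {2}/cech_diff (big_setD1 t) //= (card_below_D1 (t |: S) t t) TS ltnn andbF add0n.
rewrite mulrDr mulrDr; congr (_ + _).
  by rewrite mulrCA signrMK.
rewrite /cech_diff -sumrN !mulr_sumr; apply: eq_bigr => s sS.
have st : s != t by apply: contraNneq tS => <-.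
rewrite /homotopy !inE (negbTE tS) andbF.
have -> : (t |: S) :\ s = t |: (S :\ s).
  by rewrite setDUl (setDidPl _) // disjoints1 inE eq_sym.
rewrite (card_below_D1 (t |: S) s t) tT TS (card_below_D1 S t s) sS /=.
by case: ltngtP st => // [lt|lt|/val_inj ->]; rewrite ?eqxx //= => _;
  rewrite ?add0n !exprS; ring.
Qed.

Lemma cocycle_torsion : exists N, forall M, (N <= M)%N ->
  coboundary I i (j + M%:Z) (fun S => Xt ^+ M * c S).
Proof.
have [N HN] := homotopy_deg; have [N' HN'] := torsion_diff.
exists (maxn N N') => M; rewrite geq_max => /andP[le_NM le_NM'].
exists (homotopy M); split=> [|S HS]; first exact: HN.
rewrite homotopyE //; case: ifP => tS; first exact: loc_ideal0.
apply: loc_ideal_sign; have := HN' _ le_NM' (t |: S).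
by rewrite setU1K ?tS // cardsU1 tS HS add1n; apply; rewrite ?setU11.
Qed.

End Torsion.

Definition torsion h : Prop := forall I i j c, cocycle I i j c ->
  exists N, coboundary I i (j + N%:Z) (fun S => tofrac h ^+ N * c S).

Lemma torsionX t : torsion 'X_t.
Proof. by move=> I i j c /cocycle_torsion-/(_ t)[N HN]; exists N; apply: HN. Qed.

(** Expand the power [M + M] by the binomial theorem: in each term ['X_s] or ['X_t] has exponent at
    least [M], and such a power already makes [c] a coboundary. *)
Lemma torsionXB s t : torsion ('X_s - 'X_t).
Proof.
move=> I i j c Hc.
have [N HN] := cocycle_torsion s Hc; have [N' HN'] := cocycle_torsion t Hc.
set M := maxn N N'; exists (M + M)%N.
have hX (r : 'I_n.+1) : zhomog 1 ('X_r : R) by apply/(zhomogP 1); rewrite dhomogX /= mdeg1.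
have hC D f l m : zhomog D f -> zhomog D ((-1) ^+ l * f *+ m).
  move=> Hf; elim: m => [|m IH]; first by rewrite mulr0n; apply: zhomog0.
  rewrite mulrSr; apply: zhomogD => //; rewrite -signr_odd.
  by case: odd; rewrite ?mulN1r ?mul1r //; apply: zhomogN.
have hXn (r : 'I_n.+1) m : zhomog m%:Z ('X_r ^+ m : R).
  by rewrite -[m%:Z]mul1r; apply: zhomogX.
pose G (l : nat) S : F :=
  ((-1) ^+ l * tofrac 'X_s ^+ (M + M - l) * tofrac 'X_t ^+ l *+ 'C(M + M, l)) * c S.
apply: (@eq_coboundary _ _ _ (fun S => \sum_(l < (M + M).+1) G l S)).
  by move=> S; rewrite /G -mulr_suml rmorphB exprBn.
have GP (l : nat) : (l <= M + M)%N -> coboundary I i (j + (M + M)%:Z) (G l).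
  move=> le_l; case: (leqP M l) => lM.
    have le_N'l : (N' <= l)%N by apply: leq_trans lM; exact: leq_maxr.
    have := coboundaryM (hC _ _ l 'C(M + M, l) (hXn s (M + M - l)%N)) (HN' _ le_N'l).
    rewrite -addrA -PoszD subnKC //; apply: eq_coboundary => S.
    by rewrite /G mulrA rmorphMn rmorphM !rmorphXn rmorphN1 /= mulrnAl.
  have le_Nl : (N <= M + M - l)%N by apply: (leq_trans (leq_maxl N N')); lia.
  have := coboundaryM (hC _ _ l 'C(M + M, l) (hXn t l)) (HN _ le_Nl).
  rewrite -addrA -PoszD subnK //; apply: eq_coboundary => S.
  by rewrite /G mulrA rmorphMn rmorphM !rmorphXn rmorphN1 /= mulrnAl mulrAC.
have : forall m, (m <= (M + M).+1)%N ->
    coboundary I i (j + (M + M)%:Z) (fun S => \sum_(l < m) G l S).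
  elim=> [_|m IH lt_m].
    by apply: eq_coboundary (coboundary0 _ _ _) => S; rewrite big_ord0.
  apply: eq_coboundary (coboundaryD (IH (ltnW lt_m)) (GP m _)) => // S.
  by rewrite big_ord_recr.
exact.
Qed.

Definition vanishes_above (r : int) (I : hideal k n) : Prop :=
  forall i j c, r < i%:Z + j -> cocycle I i j c -> coboundary I i j c.

(** * From a hyperplane section back to the ring *)

Section Hyperplane.
Variables (I : hideal k n) (h : R).
Hypothesis h_homog : h \is 1.-homog.

Lemma pihomogMl (d : nat) f : pihomog mdeg d.+1 (h * f) = h * pihomog mdeg d f.
Proof.
rewrite [f]mpolyE mulr_sumr !linear_sum /= mulr_sumr; apply: eq_bigr => m _.
rewrite -scalerAr !linearZ /= -scalerAr; congr (_ *: _).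
have H : h * 'X_[m] \is (mdeg m).+1.-homog by apply: (dhomogM h_homog); rewrite dhomogX.
rewrite pihomogX /=; case: eqP => [<-|/eqP ne]; first exact: pihomog_dE.
by rewrite mulr0; apply: pihomog_ne0 H; rewrite eqSS.
Qed.

Lemma pihomogMl0 f : pihomog mdeg 0 (h * f) = 0.
Proof.
rewrite [f]mpolyE mulr_sumr linear_sum /= big1 // => m _.
rewrite -scalerAr linearZ /= (@pihomog_ne0 _ _ _ (mdeg m).+1) ?scaler0 //.
by apply: (dhomogM h_homog); rewrite dhomogX.
Qed.

Definition adjoin_mem f : Prop := exists2 g, I g & exists a, f = g + h * a.

Lemma adjoin0 : adjoin_mem 0.
Proof. by exists 0; [exact: hideal0|exists 0; rewrite mulr0 addr0]. Qed.

Lemma adjoinD f g : adjoin_mem f -> adjoin_mem g -> adjoin_mem (f + g).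
Proof.
move=> [f1 If1 [a ->]] [g1 Ig1 [b ->]]; exists (f1 + g1); first exact: hidealD.
by exists (a + b); rewrite mulrDr addrACA.
Qed.

Lemma adjoinM a f : adjoin_mem f -> adjoin_mem (a * f).
Proof.
move=> [g Ig [b ->]]; exists (a * g); first exact: hidealM.
by exists (a * b); rewrite mulrDr mulrCA.
Qed.

Lemma adjoin_homog d f : adjoin_mem f -> adjoin_mem (pihomog mdeg d f).
Proof.
move=> [g Ig [b ->]]; exists (pihomog mdeg d g); first exact: hideal_homog.
case: d => [|d]; first by exists 0; rewrite linearD /= pihomogMl0 mulr0.
by exists (pihomog mdeg d b); rewrite linearD /= pihomogMl.
Qed.

Definition adjoin : hideal k n := HIdeal adjoin0 adjoinD adjoinM adjoin_homog.

Lemma adjoin_sub f : I f -> adjoin f.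
Proof. by move=> If; exists f => //; exists 0; rewrite mulr0 addr0. Qed.

Lemma adjoin_mul a : adjoin (h * a).
Proof. by exists 0; [exact: hideal0|exists a; rewrite add0r]. Qed.

Variable r : int.
Hypothesis h_torsion : torsion h.
Hypothesis h_colon : forall (d : nat) f,
  r < d%:Z -> f \is d.-homog -> I (h * f) -> I f.
Local Notation J := adjoin.

(* An element of degree [j + 1] of the localization of [J] splits with the
   multiplier of [h] of degree exactly [j]. *)
Lemma loc_ideal_split U j u : loc_deg U (j + 1) u -> loc_ideal J U u ->
  exists v w, [/\ loc_ideal I U v, loc_deg U j w & u = v + tofrac h * w].
Proof.
move=> [N [f [Hf Eu]]] [N' [g [Jg Eu']]].
set x := xprod k U in Eu Eu' *.
have Efg : x ^+ N' * f = x ^+ N * g.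
  have := tofrac_div_inj (xprodX_neq0 U N) (xprodX_neq0 U N') (etrans (esym Eu) Eu').
  by rewrite mulrC => ->; rewrite mulrC.
have {Jg} : J (x ^+ N' * f) by rewrite Efg; apply: hidealM.
have {Efg g Eu'} -> : u = tofrac (x ^+ N' * f) / tofrac x ^+ (N' + N).
  by rewrite Eu frac_shift.
have : zhomog (j + 1 + ((N' + N) * #|U|)%:Z) (x ^+ N' * f).
  have -> : j + 1 + ((N' + N) * #|U|)%:Z = #|U|%:Z * N'%:Z + (j + 1 + (N * #|U|)%:Z) by lia.
  by apply: zhomogM => //; apply/zhomogX/zhomog_xprod.
move: (x ^+ N' * f) (N' + N)%N => {f Hf Eu u N N'} f N Hf [g Ig [a Ef]].
have [E|nz] := eqVneq f 0.
  exists 0, 0; split; [exact: loc_ideal0|exact: loc_deg0|].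
  by rewrite E rmorph0 mul0r mulr0 addr0.
have [d Ed] : exists d : nat, j + 1 + (N * #|U|)%:Z = d%:Z.
  by exists (mdeg (mlead f)); rewrite (Hf _ (mlead_supp nz)).
have {Ef} Ef : f = pihomog mdeg d g + pihomog mdeg d (h * a).
  by rewrite -linearD /= -Ef pihomog_dE //; apply/zhomogP; rewrite -Ed.
have Ig' : I (pihomog mdeg d g) by apply: hideal_homog.
case: d Ed Ef Ig' => [|d] Ed Ef Ig'.
  exists (tofrac f / tofrac x ^+ N), 0; split; last by rewrite mulr0 addr0.
    by exists N, f; split=> //; rewrite Ef pihomogMl0 addr0.
  exact: loc_deg0.
exists (tofrac (pihomog mdeg d.+1 g) / tofrac x ^+ N), (tofrac (pihomog mdeg d a) / tofrac x ^+ N).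
split; first by exists N, (pihomog mdeg d.+1 g).
  exists N, (pihomog mdeg d a); split=> //.
  have -> : j + (N * #|U|)%:Z = d%:Z by lia.
  by apply/zhomogP/pihomogP.
by rewrite {1}Ef pihomogMl rmorphD rmorphM mulrDl mulrA.
Qed.

(** Cancelling [h] is only allowed above degree [r], so the numerator is first multiplied by a power
    of [xprod k S], which raises its degree when [S] is nonempty; for empty [S] the degree is [j],
    above [r] by assumption. *)
Lemma loc_ideal_colon S j u : loc_deg S j u -> r < #|S|%:Z + j ->
  loc_ideal I S (tofrac h * u) -> loc_ideal I S u.
Proof.
move=> [N [f [Hf ->]]] lt_r [N' [g [Ig Eg]]].
set x := xprod k S in Eg *.
have Efg : h * (x ^+ N' * f) = x ^+ N * g.
  move: Eg; rewrite mulrA -rmorphM => Eg.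
  have := tofrac_div_inj (xprodX_neq0 S N) (xprodX_neq0 S N') Eg.
  by rewrite [g * _]mulrC => <-; ring.
have [K HK] : exists K : nat, r < j + ((N + N' + K) * #|S|)%:Z.
  have [E|nz] := posnP #|S|; first by exists 0%N; move: lt_r; rewrite E; lia.
  exists (`|r|%N + `|j|%N).+1.
  have := leq_pmulr (N + N' + (`|r|%N + `|j|%N).+1) nz; lia.
have Hf' : zhomog (j + ((N + N' + K) * #|S|)%:Z) (x ^+ (N' + K) * f).
  have -> : j + ((N + N' + K) * #|S|)%:Z =
    #|S|%:Z * (N' + K)%:Z + (j + (N * #|S|)%:Z) by lia.
  by apply: zhomogM => //; apply/zhomogX/zhomog_xprod.
exists (N' + K + N)%N, (x ^+ (N' + K) * f); split; last first.
  by rewrite frac_shift.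
have [E|nz] := eqVneq (x ^+ (N' + K) * f) 0; first by rewrite E; apply: hideal0.
have [d Ed] : exists d : nat, j + ((N + N' + K) * #|S|)%:Z = d%:Z.
  by exists (mdeg (mlead (x ^+ (N' + K) * f))); rewrite (Hf' _ (mlead_supp nz)).
apply: (@h_colon d); [by rewrite -Ed|by apply/zhomogP; rewrite -Ed|].
rewrite (_ : _ * _ = x ^+ K * (h * (x ^+ N' * f))); last by rewrite exprD; ring.
by rewrite Efg; do 2![apply: hidealM].
Qed.

(** The step of the long exact sequence. If [h c = d b] modulo [I], then [b] is a cocycle modulo [J]
    with the same total degree, so [b = d a] modulo [J] and [b - d a = v + h w] with [v] in the
    localized [I]. Then [h (c - d w)] is in the localized [I], and [h] cancels. *)
Lemma coboundary_div i j c : vanishes_above r J -> r < i%:Z + j -> cocycle I i j c ->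
  coboundary I i (j + 1) (fun S => tofrac h * c S) -> coboundary I i j c.
Proof.
move=> vanJ lt_r Hc [b [Hb Hdb]].
have hJ S j' u : loc_deg S j' u -> loc_ideal J S (tofrac h * u).
  move=> [N [f [_ ->]]]; exists N, (h * f); rewrite rmorphM mulrA; split=> //.
  exact: adjoin_mul.
have [a Ha] : exists a, forall U, #|U|.+1 = i -> loc_deg U (j + 1) (b U - cech_diff a U) /\
    loc_ideal J U (b U - cech_diff a U).
  case: i lt_r Hc Hb Hdb => [|i] lt_r Hc Hb Hdb; first by exists (fun=> 0).
  have cb : cocycle J i (j + 1) b.
    split=> [S HS|T HT]; first by apply: Hb; rewrite HS.
    have -> : cech_diff b T = tofrac h * c T - (tofrac h * c T - cech_diff b T).
      by rewrite opprB addrC subrK.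
    by apply: loc_idealB; [exact: hJ (Hc.1 _ HT)|exact: loc_ideal_sub adjoin_sub (Hdb _ HT)].
  have [|a [Ha Ha']] := vanJ _ _ _ _ cb; first by lia.
  exists a => U [HU]; split; last exact: Ha'.
  apply: loc_degD; first by apply: Hb; rewrite HU.
  apply: loc_degN; rewrite /cech_diff.
  elim/big_ind: _ => [|u v|t tU]; [exact: loc_deg0|exact: loc_degD|].
  apply: loc_deg_sign; apply: (loc_degW (subD1set U t)); apply: Ha.
  by rewrite -HU (cardsD1 t U) tU.
have split_b U : exists p : F * F, #|U|.+1 = i ->
    [/\ loc_ideal I U p.1, loc_deg U j p.2 & b U - cech_diff a U = p.1 + tofrac h * p.2].
  have [HU|HU] := eqVneq #|U|.+1 i; last by exists (0, 0) => E; rewrite E eqxx in HU.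
  by have [/loc_ideal_split H /H[v [w ?]]] := Ha _ HU; exists (v, w).
have [p Hp] := fin_all_exists split_b.
exists (fun U => (p U).2); split=> [U /Hp[]//|S HS].
have Hc2 : loc_deg S j (c S - cech_diff (fun U => (p U).2) S).
  apply: loc_degD; first exact: Hc.1.
  apply: loc_degN; rewrite /cech_diff.
  elim/big_ind: _ => [|u v|t tS]; [exact: loc_deg0|exact: loc_degD|].
  apply: loc_deg_sign; apply: (loc_degW (subD1set S t)).
  by have [] := Hp (S :\ t); rewrite // -HS (cardsD1 t S) tS.
apply: (loc_ideal_colon Hc2); first by rewrite HS.
rewrite mulrBr -cech_diffM.
have Eb : cech_diff b S =
    cech_diff (fun U => (p U).1) S + cech_diff (fun U => tofrac h * (p U).2) S.
  rewrite -[LHS]subr0 -(cech_diffK a S) -cech_diffD /cech_diff -sumrB.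
  apply: eq_bigr => t tS; rewrite -mulrBr; congr (_ * _).
  by have [] := Hp (S :\ t); rewrite // -HS (cardsD1 t S) tS.
have -> : tofrac h * c S - cech_diff (fun U => tofrac h * (p U).2) S =
  (tofrac h * c S - cech_diff b S) + cech_diff (fun U => (p U).1) S.
  by rewrite Eb opprD addrA addrAC subrK.
apply: loc_idealD; first exact: Hdb.
rewrite /cech_diff; elim/big_ind: _ => [|u v|t tS]; [exact: loc_ideal0|exact: loc_idealD|].
apply: loc_ideal_sign; apply: (loc_idealW (subD1set S t)).
by have [] := Hp (S :\ t); rewrite // -HS (cardsD1 t S) tS.
Qed.

(** Some [h ^ N c] is a coboundary. The factors [h] are divided out one at a time, all degrees
    involved being above [r]. *)
Lemma vanishes_above_hyperplane : vanishes_above r J -> vanishes_above r I.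
Proof.
move=> vanJ i j c lt_r Hc; have [N HN] := h_torsion Hc.
elim: N j c lt_r Hc HN => [|N IH] j c lt_r Hc HN.
  by rewrite addr0 in HN; apply: eq_coboundary HN => S; rewrite mul1r.
have Hh : zhomog 1 h by apply/(zhomogP 1).
apply: coboundary_div => //; apply: IH; [by lia|exact: cocycleM|].
have -> : j + 1 + N%:Z = j + N.+1%:Z by lia.
by apply: eq_coboundary HN => S; rewrite exprSr mulrA.
Qed.

End Hyperplane.

Lemma vanishes_above_artinian (I : hideal k n) (r : int) :
  (forall (d : nat) f, r < d%:Z -> f \is d.-homog -> I f) -> vanishes_above r I.
Proof.
move=> HI i j c lt_r Hc; exists (fun=> 0); split=> [U _|S HS]; first exact: loc_deg0.
rewrite (_ : cech_diff _ _ = 0) ?subr0; last by rewrite /cech_diff big1 // => t _; rewrite mulr0.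
have [N [f [Hf ->]]] := Hc.1 _ HS.
have [K HK] : exists K : nat, r < j + ((N + K) * #|S|)%:Z.
  have [E|nz] := posnP #|S|; first by exists 0%N; move: lt_r; rewrite -HS E; lia.
  exists (`|r|%N + `|j|%N).+1.
  have := leq_pmulr (N + (`|r|%N + `|j|%N).+1) nz; lia.
have Hf' : zhomog (j + ((N + K) * #|S|)%:Z) (xprod k S ^+ K * f).
  have -> : j + ((N + K) * #|S|)%:Z =
    #|S|%:Z * K%:Z + (j + (N * #|S|)%:Z) by lia.
  by apply: zhomogM => //; apply/zhomogX/zhomog_xprod.
exists (K + N)%N, (xprod k S ^+ K * f); split; last first.
  by rewrite frac_shift.
have [E|nz] := eqVneq (xprod k S ^+ K * f) 0; first by rewrite E; apply: hideal0.
have [d Ed] : exists d : nat, j + ((N + K) * #|S|)%:Z = d%:Z.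
  by exists (mdeg (mlead (xprod k S ^+ K * f))); rewrite (Hf' _ (mlead_supp nz)).
by apply: (HI d); [rewrite -Ed|apply/zhomogP; rewrite -Ed].
Qed.

End Cech.

(** * Koszul cocycles and depth *)

Section Depth.
Context (k : fieldType) (n : nat).
Local Notation R := {mpoly k[n.+1]}.
Implicit Types (I : hideal k n) (f g : R).

Lemma hidealN I f : I f -> I (- f).
Proof. by rewrite -mulN1r; apply: hidealM. Qed.

Lemma hidealB I f g : I f -> I g -> I (f - g).
Proof. by move=> If Ig; apply/hidealD/hidealN. Qed.

Lemma hideal_sum I (J : finType) (P : pred J) (E : J -> R) :
  (forall x, P x -> I (E x)) -> I (\sum_(x | P x) E x).
Proof. by move=> H; elim/big_ind: _; [exact: hideal0|exact: hidealD|]. Qed.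

(* [rho] represents a Koszul 1-cocycle of R/I, i.e. an element of Ext^1(k, R/I)
   that is not zero. *)
Lemma depth_le1 I (rho : 'I_n.+1 -> R) s :
  (forall i j, I ('X_i * rho j - 'X_j * rho i)) ->
  (forall psi, exists i, ~ I (rho i - 'X_i * psi)) ->
  regular_seq I s -> (size s <= 1)%N.
Proof.
move=> Hrho Hpsi; case: s => [|f1 [|f2 s]] //= [[a1 E1] reg1 [[a2 E2] reg2 _]].
pose w := \sum_i a1 i * rho i.
have Hw i : I ('X_i * w - f1 * rho i).
  rewrite E1 /w mulr_sumr mulr_suml -sumrB; apply: hideal_sum => j _.
  rewrite (_ : _ - _ = a1 j * ('X_i * rho j - 'X_j * rho i)); last by ring.
  exact: hidealM.
have [psi Hpsi1] : exists a, I (w - a * f1).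
  apply: reg2; exists (\sum_i a2 i * rho i).
  rewrite E2 !mulr_suml -sumrB; apply: hideal_sum => i _.
  rewrite (_ : _ - _ = a2 i * ('X_i * w - f1 * rho i)); last by ring.
  exact: hidealM.
have [i []] := Hpsi psi; apply: reg1.
rewrite (_ : _ * _ = 'X_i * (w - psi * f1) - ('X_i * w - f1 * rho i)); last by ring.
by apply: hidealB => //; apply: hidealM.
Qed.

(** [phi] represents a Koszul 2-cocycle that is not a coboundary, a nonzero class in Ext^2(k, R/I).
    Contracting it with three members of a regular sequence and cancelling them again would make it
    a coboundary. *)
Lemma depth_le2_koszul I (phi : 'I_n.+1 -> 'I_n.+1 -> R) s :
  (forall i j l, I ('X_j * phi i l - 'X_i * phi j l + 'X_l * phi j i)) ->
  (forall psi, exists i j, ~ I (phi i j - ('X_i * psi j - 'X_j * psi i))) ->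
  regular_seq I s -> (size s <= 2)%N.
Proof.
move=> Hphi Hpsi; case: s => [|f1 [|f2 [|f3 s]]] //=.
move=> [[a1 E1] reg1 [[a2 E2] reg2 [[a3 E3] reg3 _]]].
pose b i := \sum_j a1 j * phi j i.
have Hb i l : I (f1 * phi i l - ('X_i * b l - 'X_l * b i)).
  rewrite E1 /b !mulr_sumr mulr_suml -!sumrB; apply: hideal_sum => j _.
  rewrite (_ : _ - _ = a1 j * ('X_j * phi i l - 'X_i * phi j l + 'X_l * phi j i)); last by ring.
  exact: hidealM.
clearbody b; pose w := \sum_i a2 i * b i.
pose u i := \sum_j a2 j * phi i j.
have Hu i : I (f2 * b i - ('X_i * w - f1 * u i)).
  rewrite E2 /w /u mulr_suml !mulr_sumr -!sumrB; apply: hideal_sum => j _.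
  rewrite (_ : _ - _ = a2 j * (f1 * phi i j - ('X_i * b j - 'X_j * b i))); last by ring.
  exact: hidealM.
clearbody w u.
(* Contraction with [f3] puts [f3 * w] in the ideal of [f1] and [f2] modulo [I]. Cancelling [f3],
   [f2] and [f1] in turn determines [w], [b] and finally [phi]. *)
have [q [p Hw]] : exists q, exists p, I (w - q * f2 - p * f1).
  apply: reg3; exists (\sum_i a3 i * b i), (\sum_i a3 i * u i).
  rewrite E3 !mulr_suml -!sumrB; apply: hideal_sum => i _.
  rewrite (_ : _ - _ = - a3 i * (f2 * b i - ('X_i * w - f1 * u i))); last by ring.
  exact: hidealM.
have /fin_all_exists[psi Hpsi'] i : exists c, I (b i - 'X_i * q - c * f1).
  apply: reg2; exists ('X_i * p - u i).
  rewrite (_ : _ - _ = 'X_i * (w - q * f2 - p * f1) + (f2 * b i - ('X_i * w - f1 * u i))).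
    by apply: hidealD => //; apply: hidealM.
  by ring.
have [i [l []]] := Hpsi psi; apply: reg1.
rewrite (_ : _ * _ = (f1 * phi i l - ('X_i * b l - 'X_l * b i)) +
  ('X_i * (b l - 'X_l * q - psi l * f1) - 'X_l * (b i - 'X_i * q - psi i * f1))); last by ring.
by apply: hidealD => //; apply: hidealB; apply: hidealM.
Qed.

(* The Koszul 2-cocycle [\sum_(j != o) rho j dx_o dx_j]. *)
Lemma depth_le2 I o (rho : 'I_n.+1 -> R) s :
  (forall i j, i != o -> j != o -> I ('X_i * rho j - 'X_j * rho i)) ->
  (forall psi, exists2 i, i != o & ~ I (rho i - ('X_o * psi i - 'X_i * psi o))) ->
  regular_seq I s -> (size s <= 2)%N.
Proof.
move=> Hrho Hpsi; pose phi i j : R :=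
  if i == o then if j == o then 0 else rho j else if j == o then - rho i else 0.
apply: (@depth_le2_koszul _ phi) => [i j l|psi]; last first.
  by have [i ni Hi] := Hpsi psi; exists o, i; rewrite /phi eqxx (negbTE ni).
rewrite /phi; case: (eqVneq i o) => [->|ni]; case: (eqVneq j o) => [->|nj];
  case: (eqVneq l o) => [->|nl]; rewrite ?mulr0 ?subr0 ?addr0 ?sub0r ?add0r ?subrr;
  try exact: hideal0.
- by rewrite addNr; apply: hideal0.
- by rewrite mulrN; apply: Hrho.
- by rewrite mulrN addNr; apply: hideal0.
- by rewrite addrC; apply: Hrho.
- by rewrite !mulrN opprK addrC; apply: Hrho.
Qed.

End Depth.

(** * Prime ideals and dimension *)

Section Points.
Context (k : fieldType) (n : nat).
Local Notation R := {mpoly k[n.+1]}.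
Implicit Types (I Z P : hideal k n) (f g : R).

Lemma point_irreducible P : is_point P -> irreducible_closed P.
Proof.
move=> HP; have VP : V P P by split.
split=> [|B C HBC]; first by exists P.
by case: (HBC P VP) => -[_ H]; [left|right] => Q [HQ PQ]; split=> // f /H /PQ.
Qed.

Lemma point_exp P f m : is_point P -> P (f ^+ m) -> P f.
Proof.
case=> P1 PM _; elim: m => [/P1[]|m IH]; rewrite exprS.
by case/PM.
Qed.

Lemma homog_notin I P : is_point P -> ~ (forall f, I f -> P f) ->
  exists d g, [/\ g \is d.-homog, I g & ~ P g].
Proof.
move=> HP nIP; apply: NNPP => H; apply: nIP => f If.
rewrite (@pihomog_partitionE _ _ mdeg (msize f) f) //.
apply: hideal_sum => d _; apply: NNPP => nP; apply: H.
exists d, (pihomog mdeg d f); split=> //; [exact: pihomogP|exact: hideal_homog].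
Qed.

Lemma point_neq0 P f : ~ P f -> tofrac f != 0.
Proof. by move=> nPf; rewrite tofrac_eq0; apply: contra_notN nPf => /eqP->; apply: hideal0. Qed.

(** At a point not containing [X] some homogeneous [f] in [X] is outside [P], and multiplying
    numerator and denominator by [f] shows that the ideal stalk is the whole local ring. At the
    other points, clear denominators and use that [X] is prime. *)
Lemma point_reduced (X : closed_subscheme k n) : is_point X -> reduced X.
Proof.
move=> HX P HP u m [d [g [h [Hg Hh nPh ->]]]] [d' [g' [h' [[Hg' Xg'] Hh' nPh' E]]]].
have [[P1 PM _] [X1 XM _]] := (HP, HX).
have [XP|nXP] := classic (forall f, X f -> P f); last first.
  have [e [f [Hf Xf nPf]]] := homog_notin HP nXP.
  exists (d + e)%N, (g * f), (h * f); split; last 1 first.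
  - by rewrite !rmorphM -mulf_div divff ?mulr1 // (point_neq0 nPf).
  - by split; [apply: dhomogM|apply: hidealM].
  - exact: dhomogM.
  - by case/PM.
exists d, g, h; split=> //; split=> //.
apply: (@point_exp _ _ m HX); have [|/XP//] : X (g ^+ m) \/ X h'; last by [].
apply: XM; rewrite (_ : _ * h' = h ^+ m * g'); first exact: hidealM.
apply/eqP; rewrite -tofrac_eq !rmorphM !rmorphXn /=.
have nPhm : tofrac h ^+ m != 0 by rewrite expf_neq0 // (point_neq0 nPh).
move/eqP: E; rewrite expr_div_n (eqr_div _ _ nPhm (point_neq0 nPh')) => /eqP->.
by rewrite mulrC.
Qed.

Definition vanishing Z f : Prop := forall P, V Z P -> P f.

Lemma vanishing_sub Z Z' : sub_points (V Z) (V Z') -> forall f, vanishing Z' f -> vanishing Z f.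
Proof. by move=> H f Hf P /H /Hf. Qed.

Lemma vanishing_sep Z Z' : ~ sub_points (V Z') (V Z) -> exists2 f, vanishing Z f & ~ vanishing Z' f.
Proof.
move=> H; apply: NNPP => nf; apply: H => P VP.
split=> [|f Zf]; first by case: VP.
by apply: NNPP => nPf; apply: nf; exists f => [Q [_ /(_ _ Zf)]|/(_ _ VP)].
Qed.

Lemma point_hull_homog f d g : (forall P, is_point P -> P f -> P g) ->
  forall P, is_point P -> P f -> P (pihomog mdeg d g).
Proof. by move=> H P HP Pf; apply/hideal_homog/H. Qed.

(** As [f] need not be homogeneous, the ideal it generates is replaced by the intersection of the
    points containing it, whose zero set is exactly these points. Irreducibility can then be tested
    on [f]. *)
Definition point_hull f : hideal k n :=
  @HIdeal k n (fun g => forall P, is_point P -> P f -> P g)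
    (fun P _ _ => hideal0 P)
    (fun g h Hg Hh P HP Pf => hidealD (Hg P HP Pf) (Hh P HP Pf))
    (fun a g Hg P HP Pf => hidealM a (Hg P HP Pf))
    (fun d g => @point_hull_homog f d g).

Lemma vanishing_prime Z f g : irreducible_closed Z ->
  vanishing Z (f * g) -> vanishing Z f \/ vanishing Z g.
Proof.
move=> [_ irr] Hfg; case: (irr (point_hull f) (point_hull g)) => [P VP|H|H].
- have [HP _] := VP; have [_ PM _] := HP.
  by have /PM[Pf|Pg] := Hfg P VP; [left|right]; split=> // h; apply.
- by left=> P /H[_]; apply.
- by right=> P /H[_]; apply.
Qed.

Lemma vanishingD Z f g : vanishing Z f -> vanishing Z g -> vanishing Z (f + g).
Proof. by move=> Hf Hg P VP; apply: hidealD; auto. Qed.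

Lemma vanishingM Z f g : vanishing Z g -> vanishing Z (f * g).
Proof. by move=> Hg P VP; apply: hidealM; auto. Qed.

Definition free_mod (J : R -> Prop) (T : finType) (w : T -> R) : Prop :=
  forall c : T -> k, J (\sum_t c t *: w t) -> forall t, c t = 0.

(** Some variable is nonzero at a point of [Z]. Its powers have distinct degrees, so a homogeneous
    ideal containing a nontrivial relation would contain one of these powers. *)
Lemma free_powers Z : irreducible_closed Z ->
  exists f, forall N, free_mod (vanishing Z) (fun i : 'I_N => f ^+ i).
Proof.
move=> irr; have [[P VP] _] := irr; have [[P1 PM [i nPi]] _] := VP.
exists 'X_i => N c Hc a; apply/eqP/negP => /negP nz.
have : vanishing Z ('X_i ^+ a).
  rewrite -['X_i ^+ a](scalerK nz) -mul_mpolyC; apply: vanishingM.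
  suff -> : c a *: 'X_i ^+ a = pihomog mdeg a (\sum_t c t *: 'X_i ^+ t).
    by move=> Q VQ; apply/hideal_homog/Hc.
  rewrite linear_sum (bigD1 a) //= big1 ?addr0 => [|b ba]; rewrite linearZ /= mpolyXn pihomogX /=.
    by rewrite mdegMn mdeg1 mul1n eqxx.
  by rewrite mdegMn mdeg1 mul1n val_eqE (negbTE ba) scaler0.
move/(_ P VP); elim: (nat_of_ord a) => [|m IH]; first by rewrite expr0.
by rewrite exprS => /PM[].
Qed.

(** In a relation, the part without [f] lies in [J'] because [f] does, so its coefficients are zero.
    Primality of [J] then cancels one factor [f], and the argument repeats. *)
Lemma free_mod_mulX (J J' : R -> Prop) (T : finType) (w : T -> R) f N :
  (forall g, J g -> J' g) -> (forall g h, J' g -> J' h -> J' (g + h)) ->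
  (forall g h, J' h -> J' (g * h)) -> (forall g h, J (g * h) -> J g \/ J h) ->
  J' f -> ~ J f -> free_mod J' w ->
  free_mod J (fun t : 'I_N * T => f ^+ t.1 * w t.2).
Proof.
move=> subJ J'D J'M Jp J'f nJf fr c.
have : forall (c : nat -> T -> k), J (\sum_(i < N) \sum_t c i t *: (f ^+ i * w t)) ->
    forall (i : 'I_N) t, c i t = 0.
  elim: N {c} => [c _ []//|N IH] c.
  rewrite big_ord_recl /=.
  have -> : \sum_(i < N) \sum_t c (bump 0 i) t *: (f ^+ bump 0 i * w t) =
      f * \sum_(i < N) \sum_t c i.+1 t *: (f ^+ i * w t).
    rewrite mulr_sumr; apply: eq_bigr => i _; rewrite mulr_sumr; apply: eq_bigr => t _.
    by rewrite -scalerAr mulrA -exprS.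
  set A := \sum_t _; set B := \sum_(i < N) _ => HJ.
  have c0 t : c 0%N t = 0.
    apply: fr; suff -> : \sum_t c 0%N t *: w t = (A + f * B) + (- B) * f.
      by apply: J'D; [exact: subJ|exact: J'M].
    rewrite mulNr [B * f]mulrC addrK; apply: eq_bigr => s _.
    by rewrite expr0 mul1r.
  have A0 : A = 0 by rewrite /A big1 // => t _; rewrite c0 scale0r.
  move: HJ; rewrite A0 add0r => /Jp[//|HB] i t.
  case: (unliftP ord0 i) => [i' ->|->]; last exact: c0.
  exact: (IH (fun i => c i.+1)).
move=> H Hc [i t]; pose c' (i : nat) t := if insub i is Some j then c (j, t) else 0.
have c'E (j : 'I_N) s : c' j s = c (j, s).
  by rewrite /c' insubT //= => ltj; congr (c (_, _)); apply: val_inj.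
rewrite -c'E; apply: H; rewrite pair_bigA /=.
rewrite (eq_bigr (fun p => c p *: (f ^+ p.1 * w p.2))) // => -[j s] _ /=.
by rewrite c'E.
Qed.

Definition deg_le d f := {in msupp f, forall m, (mdeg m <= d)%N}.

Lemma deg_leM d e f g : deg_le d f -> deg_le e g -> deg_le (d + e) (f * g).
Proof.
move=> Hf Hg m /msuppM_le/allpairsP[[m1 m2] /= [/Hf H1 /Hg H2 ->]].
by rewrite mdegD leq_add.
Qed.

Lemma deg_leX d f i : deg_le d f -> deg_le (d * i) (f ^+ i).
Proof.
move=> Hf; elim: i => [|i IH]; last by rewrite exprS mulnS; apply: deg_leM.
by move=> m; rewrite expr0 msupp1 inE => /eqP ->; rewrite mdeg0.
Qed.

Lemma deg_leW d e f : (d <= e)%N -> deg_le d f -> deg_le e f.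
Proof. by move=> le_de Hf m /Hf /leq_trans; apply. Qed.

(* A chain of length e makes the Hilbert function grow at least like N^(e+1). *)
Lemma chain_growth I e (Z : nat -> hideal k n) : irreducible_chain I e Z ->
  exists D, forall N, exists (T : finType) (w : T -> R),
    [/\ #|T| = (N ^ e.+1)%N, free_mod I w & forall t, deg_le (D * N)%N (w t)].
Proof.
move=> [HZ ltZ].
have subI f : I f -> vanishing (Z e) f.
  by move=> If P VP; have [_ /(_ P VP)[_]] := HZ e (leqnn e); apply.
suff [D HD] : exists D, forall N, exists (T : finType) (w : T -> R),
    [/\ #|T| = (N ^ e.+1)%N, free_mod (vanishing (Z e)) w
      & forall t, deg_le (D * N)%N (w t)].
  by exists D => N; have [T [w [? fr ?]]] := HD N; exists T, w; split=> // c /subI; apply: fr.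
elim: e HZ ltZ {subI} => [|e IH] HZ ltZ.
  have [f Hf] := free_powers (HZ 0%N isT).1; exists (msize f) => N.
  exists 'I_N, (fun i : 'I_N => f ^+ i); split; [by rewrite card_ord expn1|exact: Hf|].
  move=> i; apply: (@deg_leW (msize f * i)%N); first by rewrite leq_mul2l (ltnW (ltn_ord i)) orbT.
  by apply: deg_leX => m /msize_mdeg_lt /ltnW.
have [i le_i|i lt_i|D HD] := IH.
- by apply: HZ; apply: leqW.
- by apply: ltZ; apply: leqW.
have [sub nsub] := ltZ e (leqnn _).
have [f Zf nZf] := vanishing_sep nsub; exists (msize f + D)%N => N.
have [T [w [cT fr sz]]] := HD N.
exists ('I_N * T)%type, (fun t : 'I_N * T => f ^+ t.1 * w t.2); split.
- by rewrite card_prod card_ord cT -expnS.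
- apply: (free_mod_mulX (J' := vanishing (Z e))) Zf nZf fr.
  + exact: vanishing_sub.
  + by move=> g h; apply: vanishingD.
  + by move=> g h; apply: vanishingM.
  + by move=> g h; apply: vanishing_prime; apply: (HZ _ _).1.
- move=> t; apply: (@deg_leW (msize f * t.1 + D * N)%N).
    by rewrite mulnDl leq_add2r leq_mul2l (ltnW (ltn_ord _)) orbT.
  by apply: deg_leM => //; apply: deg_leX => m /msize_mdeg_lt /ltnW.
Qed.

End Points.

Section CongCount.
Context (k : fieldType) (n : nat) (T' : eqType) (kap : 'X_{1..n.+1} -> option T').

(** Class sums give [#|T|] vectors of length [#|C|], and a linear relation among them is a relation
    of [w] modulo [cong kap]. *)
Lemma free_mod_card (T C : finType) (w : T -> {mpoly k[n.+1]}) (code : C -> T') :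
  (forall t m, m \in msupp (w t) -> exists c, kap m = Some (code c)) ->
  free_mod (cong kap) w -> (#|T| <= #|C|)%N.
Proof.
move=> Hcode fr.
pose A := \matrix_(i < #|T|, j < #|C|)
  coefsum (fun m => kap m == Some (code (enum_val j))) (w (enum_val i)).
suff : row_free A by move/eqP=> <-; apply: rank_leq_col.
apply: inj_row_free => v Hv; apply/rowP => i; rewrite mxE.
rewrite -(enum_valK i); apply: (fr (fun t => v 0 (enum_rank t))) => c'.
rewrite linear_sum /=.
have [/existsP[c /eqP Ec]|/existsPn nc] := boolP [exists c, code c == c'].
  have := congr1 (fun M : 'rV_ _ => M 0 (enum_rank c)) Hv; rewrite !mxE => v0; rewrite -[RHS]v0.
  rewrite [RHS](reindex enum_rank) /=; last exact: onW_bij (enum_rank_bij T).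
  by apply: eq_bigr => t _; rewrite linearZ /= mxE !enum_rankK Ec.
rewrite big1 // => t _; rewrite linearZ /= coefsum0P ?mulr0 // => m /Hcode[c ->].
by apply: contra (nc c) => /eqP[->].
Qed.

End CongCount.

(** * The surface and its nonreduced companion *)

Local Notation ix i := (@Ordinal 6 i isT).

Definition mon (a b c0 c1 c2 c3 : nat) : 'X_{1..6} :=
  [multinom [tuple a; b; c0; c1; c2; c3]].

(* The variables are x, y, z0, z1, z2, z3, parametrized by u, u t, v, v t^2,
   v t^6, v t^8; a monomial x^a y^b z^c goes to u^(a + b) v^zdeg t^(b + 2 zwt). *)
Definition zdeg (m : 'X_{1..6}) : nat := m (ix 2) + m (ix 3) + m (ix 4) + m (ix 5).
Definition zwt (m : 'X_{1..6}) : nat := m (ix 3) + 3 * m (ix 4) + 4 * m (ix 5).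

Lemma mon_ext (m m' : 'X_{1..6}) :
  m (ix 0) = m' (ix 0) -> m (ix 1) = m' (ix 1) -> m (ix 2) = m' (ix 2) ->
  m (ix 3) = m' (ix 3) -> m (ix 4) = m' (ix 4) -> m (ix 5) = m' (ix 5) -> m = m'.
Proof.
move=> H0 H1 H2 H3 H4 H5; apply/mnmP => -[[|[|[|[|[|[|//]]]]]] lti];
  by rewrite (bool_irrelevance lti isT).
Qed.

Lemma mdeg6 (m : 'X_{1..6}) : mdeg m = (m (ix 0) + m (ix 1) + zdeg m)%N.
Proof.
rewrite mdegE !big_ord_recl big_ord0 /zdeg.
have E (i j : 'I_6) : val i = val j -> m i = m j by move=> /val_inj ->.
by rewrite addn0 !addnA; do !congr addn; apply: E.
Qed.

Lemma zwt_le m : (zwt m <= 4 * zdeg m)%N.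
Proof. rewrite /zwt /zdeg; lia. Qed.

(** The weights of the z variables are 0, 1, 3, 4. The missing weight 2 is what keeps u^2 v t^5 and
    u v t^5 out of the parametrized ring. *)
Lemma zwt_zdeg1 m : zdeg m = 1%N -> zwt m <> 2%N.
Proof. rewrite /zwt /zdeg; lia. Qed.

(** Weight 2 in degree one is the only gap. By the residue of [e] modulo 4, take a power of z3 times
    one of 1, z1, z1^2, z2 and fill up with z0; for residue 2 near the top weight, use z2^2 z3^(q -
    2). *)
Lemma zmon_exists q e : (e <= 4 * q)%N -> (q = 1%N -> e <> 2%N) ->
  exists c0 c1 c2 c3, [/\ (c0 + c1 + c2 + c3)%N = q & (c1 + 3 * c2 + 4 * c3)%N = e].
Proof.
move=> le_e ne2.
have [[[E|E]|E]|E] : ((e %% 4 = 0 \/ e %% 4 = 1) \/ e %% 4 = 2)%N \/ (e %% 4 = 3)%N by lia.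
- exists (q - e %/ 4)%N, 0%N, 0%N, (e %/ 4)%N; lia.
- exists (q - e %/ 4 - 1)%N, 1%N, 0%N, (e %/ 4)%N; lia.
- have [le|gt] := leqP (e %/ 4 + 2) q.
    exists (q - e %/ 4 - 2)%N, 2%N, 0%N, (e %/ 4)%N; lia.
  exists 0%N, 0%N, 2%N, (q - 2)%N; lia.
- exists (q - e %/ 4 - 1)%N, 0%N, 1%N, (e %/ 4)%N; lia.
Qed.

(* With [b = false] the classes are the fibres of the parametrization. With
   [b = true] a flag separates in addition the two terms of y^4 z1 - x^4 z2 and
   of its multiples by monomials in x and y. *)
Definition kap0 (b : bool) (m : 'X_{1..6}) : option (nat * nat * nat * bool) :=
  Some ((m (ix 0) + m (ix 1))%N, zdeg m, (m (ix 1) + 2 * zwt m)%N,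
        [&& b, zdeg m == 1%N & (m (ix 2) + m (ix 3) == 1)%N]).

(* The nonzero classes modulo x; by x^4 z2 = y^4 z1 those of y^n z1 vanish for
   n > 3 when [b = false]. *)
Definition kap1 (b : bool) (m : 'X_{1..6}) : option (nat * nat * nat) :=
  if (m (ix 0) == 0%N) && [|| (m (ix 1) <= 1)%N, zwt m == (4 * zdeg m)%N
      | [&& zdeg m == 1%N, zwt m == 1%N & b || (m (ix 1) <= 3)%N]]
  then Some (m (ix 1), zdeg m, zwt m) else None.

(* The nonzero classes modulo x and y - z0. *)
Definition kap2 (m : 'X_{1..6}) : option (nat * nat) :=
  let f := (4 * (m (ix 1) + zdeg m) - zwt m)%N in
  if (m (ix 0) == 0%N) && ((f <= 8)%N || (f <= 11)%N && (zwt m <= 2)%N)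
  then Some (m (ix 1) + zdeg m, zwt m)%N else None.

Lemma zdegD e m : zdeg (e + m) = (zdeg e + zdeg m)%N.
Proof. rewrite /zdeg !mnmDE; lia. Qed.

Lemma zwtD e m : zwt (e + m) = (zwt e + zwt m)%N.
Proof. rewrite /zwt !mnmDE; lia. Qed.

Section Classes.
Variable b : bool.

Lemma kap0_add e m m' : kap0 b m = kap0 b m' -> kap0 b (e + m) = kap0 b (e + m').
Proof.
case=> H1 H2 H3 H4; rewrite /kap0; congr (Some (_, _, _, _)).
- rewrite !mnmDE; lia.
- by rewrite !zdegD H2.
- rewrite !zwtD !mnmDE; lia.
- by case: b H4 => //= H4; move: H2 H4; rewrite /zdeg !mnmDE; lia.
Qed.

Lemma kap0_none e m : kap0 b m = None -> kap0 b (e + m) = None.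
Proof. by []. Qed.

Lemma kap0_deg m m' c : kap0 b m = Some c -> kap0 b m' = Some c -> mdeg m = mdeg m'.
Proof. by move=> <- [E1 E2 _ _]; rewrite !mdeg6 E1 E2. Qed.

Lemma kap1_none e m : kap1 b m = None -> kap1 b (e + m) = None.
Proof.
rewrite /kap1 zdegD zwtD !mnmDE; case: ifP => // H _; case: ifP => //.
by case: b H => /= H; move: H (zwt_le m) (zwt_le e); lia.
Qed.

Lemma kap1_add e m m' : kap1 b m = kap1 b m' -> kap1 b (e + m) = kap1 b (e + m').
Proof.
case Em : (kap1 b m) => [c|] Em'; last by rewrite !kap1_none.
move: Em Em'; rewrite /kap1 !zdegD !zwtD !mnmDE.
case: ifP => // /andP[/eqP a0 _] [<-]; case: ifP => // /andP[/eqP a0' _] [-> -> ->].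
by rewrite a0 a0'.
Qed.

End Classes.

Lemma kap2_none e m : kap2 m = None -> kap2 (e + m) = None.
Proof.
rewrite /kap2 zdegD zwtD !mnmDE; case: ifP => // H _; case: ifP => //.
move: H (zwt_le m) (zwt_le e); lia.
Qed.

Lemma kap2_add e m m' : kap2 m = kap2 m' -> kap2 (e + m) = kap2 (e + m').
Proof.
case Em : (kap2 m) => [c|] Em'; last by rewrite !kap2_none.
move: Em Em'; rewrite /kap2 !zdegD !zwtD !mnmDE.
case: ifP => // /andP[/eqP a0 _] [<-]; case: ifP => // /andP[/eqP a0' _] [E ->].
have D (m1 : 'X_{1..6}) : (e (ix 1) + m1 (ix 1) + (zdeg e + zdeg m1) =
  e (ix 1) + zdeg e + (m1 (ix 1) + zdeg m1))%N by rewrite addnACA.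
by rewrite a0 a0' !D E.
Qed.

(** Equal classes with different x-exponents trade y^2 for x^2 while raising [zwt] by one. A class
    that is nonzero modulo x allows this only for z1, whose weight must jump over the gap to 3 or 4,
    so at least y^4 is traded. The bound on the y-exponent excludes this for [b = false], the flag
    for [b = true]. *)
Lemma kap01 b m m' : kap0 b m = kap0 b m' -> kap1 b m = kap1 b m'.
Proof.
wlog le_a : m m' / (m (ix 0) <= m' (ix 0))%N => [H E|].
  have [|/ltnW] := leqP (m (ix 0)) (m' (ix 0)) => /H; first exact.
  by move=> -> //; rewrite E.
case=> H1 H2 H3 H4; rewrite /kap1 -H2.
have := zwt_le m; have := zwt_le m'; have := @zwt_zdeg1 m; have := @zwt_zdeg1 m'.
rewrite -H2 => ne2 ne2' le4' le4.
case: ifP => [/andP[/eqP a0 H]|H]; case: ifP => [/andP[/eqP a0' H']|H'] //.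
- by congr (Some (_, _, _)); lia.
- exfalso; case: b H4 H H' => //=; last by lia.
  by rewrite /zdeg /zwt in H2 H3 le4 le4' ne2 ne2' * => H4; lia.
- by exfalso; lia.
Qed.

Lemma kap12 b m m' : kap1 b m = kap1 b m' -> kap2 m = kap2 m'.
Proof.
have none m1 : kap1 b m1 = None -> kap2 m1 = None.
  rewrite /kap1 /kap2; case: ifP => // H _; case: ifP => // H'.
  exfalso; have := zwt_le m1; have := @zwt_zdeg1 m1.
  by case: b H => /=; lia.
case Em : (kap1 b m) => [c|] Em'; last by rewrite !none.
move: Em Em'; rewrite /kap1 /kap2.
case: ifP => // /andP[/eqP a0 _] [<-]; case: ifP => // /andP[/eqP a0' _] [-> -> ->].
by rewrite a0 a0'.
Qed.

Section CongTransfer.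
Context (k : fieldType) (n : nat) (T T' : eqType).
Variables (kap : 'X_{1..n} -> option T) (kap' : 'X_{1..n} -> option T').

Lemma cong_transfer (f : {mpoly k[n]}) : (forall m, kap m = None -> kap' m = None) ->
  (forall m m', kap m = kap m' -> kap' m = kap' m') -> cong kap f -> cong kap' f.
Proof.
move=> HN HS; apply: cong_sub.
- exact: cong0.
- exact: congD.
- exact: congZ.
- by move=> m /HN; apply: congX.
- by move=> m m' c E E'; apply/congXB/HS; rewrite E.
Qed.

End CongTransfer.

(** * The ideals of the two schemes and of their three successive hyperplane sections *)

Section Ideals.
Variable k : fieldType.
Local Notation R := {mpoly k[6]}.
Implicit Types (f g : R) (m : 'X_{1..6}).
Local Notation X i := ('X_(ix i) : R).

Definition I0 b : hideal k 5 :=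
  cong_hideal k (@kap0_add b) (@kap0_none b) (@kap0_deg b).

Lemma X_homog (i : 'I_6) : ('X_i : R) \is 1.-homog.
Proof. by rewrite dhomogX /= mdeg1. Qed.

Lemma XB_homog (i j : 'I_6) : ('X_i - 'X_j : R) \is 1.-homog.
Proof. by rewrite rpredB ?X_homog. Qed.

Definition I1 b : hideal k 5 := adjoin (I0 b) (X_homog (ix 0)).
Definition I2 b : hideal k 5 := adjoin (I1 b) (XB_homog (ix 1) (ix 2)).
Definition I3 b : hideal k 5 := adjoin (I2 b) (X_homog (ix 5)).

Lemma I0_sub f : I0 true f -> I0 false f.
Proof.
apply: cong_transfer => // m m'; rewrite /kap0 => -[H1 H2 H3 _].
by congr (Some (_, _, _, _)).
Qed.

Lemma hideal_cong_sub (T : eqType) (kap : 'X_{1..6} -> option T) (I : hideal k 5) :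
  (forall m, kap m = None -> I 'X_[m]) ->
  (forall m m' c, kap m = Some c -> kap m' = Some c -> I ('X_[m] - 'X_[m'])) ->
  forall f, cong kap f -> I f.
Proof.
move=> HN HS; apply: cong_sub => //; [exact: hideal0|exact: hidealD|].
by move=> a f If; rewrite -mul_mpolyC; apply: hidealM.
Qed.

Lemma mpolyX_split i m : m i != 0%N -> 'X_[m] = 'X_i * 'X_[m - U_(i)] :> R.
Proof.
by move=> nz; rewrite -mpolyXD addmC submK // lep1mP.
Qed.

Lemma I1_X m : m (ix 0) != 0%N -> forall b, I1 b 'X_[m].
Proof. by move=> nz b; rewrite (mpolyX_split nz); apply: adjoin_mul. Qed.

Lemma monE a b c0 c1 c2 c3 :
  [/\ mon a b c0 c1 c2 c3 (ix 0) = a, mon a b c0 c1 c2 c3 (ix 1) = b,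
      zdeg (mon a b c0 c1 c2 c3) = (c0 + c1 + c2 + c3)%N,
      zwt (mon a b c0 c1 c2 c3) = (c1 + 3 * c2 + 4 * c3)%N &
      (mon a b c0 c1 c2 c3 (ix 2) + mon a b c0 c1 c2 c3 (ix 3) = c0 + c1)%N].
Proof. by []. Qed.

(** The main point is that a monomial of class [None] without x is congruent modulo [I0] to a
    multiple of x. *)
Lemma I1E b f : I1 b f <-> cong (kap1 b) f.
Proof.
split=> [[g Ig [a ->]]|].
  apply: congD; first by apply: cong_transfer Ig => // m m'; apply: kap01.
  rewrite mulrC; apply: (cong_mul (@kap1_add b) (@kap1_none b)); apply: congX.
  by rewrite /kap1 mnm1E eqxx.
move: f; apply: hideal_cong_sub => [m|m m' c Hm Hm'].
  have [a0|nz _] := eqVneq (m (ix 0)) 0%N; last exact: I1_X.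
  rewrite /kap1; case: ifP => // H _.
  have [m' [nz E]] : exists m', m' (ix 0) != 0%N /\ kap0 b m = kap0 b m'.
    have [/andP[/eqP q1 /eqP e1]|ne] := boolP ((zdeg m == 1%N) && (zwt m == 1%N)).
      have [b0 b4] : b = false /\ (4 <= m (ix 1))%N by case: b H => /=; lia.
      (* The quintic relation y^4 z1 = x^4 z2, available for [b = false]. *)
      exists (mon 4 (m (ix 1) - 4) 0 0 1 0); split => //; rewrite /kap0 b0 /=.
      have [-> -> -> -> _] := monE 4 (m (ix 1) - 4) 0 0 1 0.
      by congr (Some (_, _, _, _)); lia.
    have H' : (2 <= m (ix 1))%N && (zwt m < 4 * zdeg m)%N by have := zwt_le m; lia.
    (* Otherwise y^2 is traded for x^2 and the weight of the z part is raised by one; since z1 alone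
       is excluded, this avoids the gap and keeps the flag. *)
    have [||c0 [c1 [c2 [c3 [Hq He]]]]] := @zmon_exists (zdeg m) (zwt m).+1; [by lia..|].
    exists (mon 2 (m (ix 1) - 2) c0 c1 c2 c3); split => //; rewrite /kap0.
    have [-> -> -> -> ->] := monE 2 (m (ix 1) - 2) c0 c1 c2 c3.
    congr (Some (_, _, _, _)); [by lia..|].
    by case: (b) => //=; move: Hq He ne; rewrite /zdeg /zwt; lia.
  rewrite -['X_[m]](subrK 'X_[m']); apply: hidealD; last exact: I1_X.
  by apply: adjoin_sub; apply: congXB.
apply: adjoin_sub; apply/congXB.
move: Hm; rewrite /kap1; case: ifP => // /andP[/eqP a0 _] [Ec].
move: Hm'; rewrite /kap1 -Ec; case: ifP => // /andP[/eqP a0' _] [E1 E2 E3].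
rewrite /kap0 a0 a0' E1 E2 E3; congr (Some (_, _, _, _)).
by case: (b) => //=; move: E2 E3; rewrite /zdeg /zwt; lia.
Qed.

Lemma I2_pow b m l : I2 b ('X_[U_(ix 1) *+ l + m] - 'X_[U_(ix 2) *+ l + m]).
Proof.
rewrite !mpolyXD -mulrBl mulrC -!mpolyXn subrXX; apply: hidealM.
exact: adjoin_mul.
Qed.

(** Modulo y - z0 every y may be replaced by z0, and z monomials of equal degree and weight already
    agree modulo [I1]. *)
Lemma I2_same b m m' : m (ix 0) = 0%N -> m' (ix 0) = 0%N ->
  (m (ix 1) + zdeg m = m' (ix 1) + zdeg m')%N -> zwt m = zwt m' ->
  I2 b ('X_[m] - 'X_[m']).
Proof.
move=> a0 a0' Hq He.
have red m1 : m1 (ix 0) = 0%N -> exists2 m2, kap1 b m2 = Some (0, m1 (ix 1) + zdeg m1, zwt m1)%N &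
    I2 b ('X_[m1] - 'X_[m2]).
  move=> a1; pose r := (m1 - U_(ix 1) *+ m1 (ix 1))%MM.
  have Er : m1 = (U_(ix 1) *+ m1 (ix 1) + r)%MM.
    apply/mnmP => i; rewrite !mnmDE mnmBE mulmnE mnm1E.
    by case: eqP => [<-|_]; lia.
  exists (U_(ix 2) *+ m1 (ix 1) + r)%MM; last by rewrite {1}Er; apply: I2_pow.
  rewrite /kap1 /zdeg /zwt /r !mnmDE !mnmBE !mulmnE !mnm1E -!val_eqE /= a1.
  rewrite !mul0n !mul1n !subn0 subnn /=.
  by congr (Some (_, _, _)); lia.
have [m1 E1 H1] := red _ a0; have [m2 E2 H2] := red _ a0'.
rewrite -(subrKA 'X_[m1]); apply: hidealD => //.
rewrite -(subrKA 'X_[m2]); apply: hidealD.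
  by apply: adjoin_sub; apply/I1E/congXB; rewrite E1 E2 Hq He.
by rewrite -opprB; apply: hidealN.
Qed.

Lemma I2E b f : I2 b f <-> cong kap2 f.
Proof.
split=> [[g /I1E Ig [a ->]]|].
  apply: congD.
    apply: cong_transfer Ig => [m Hm|m m']; last exact: kap12.
    by rewrite (@kap12 b m U_(ix 0)%MM) ?Hm /kap1 /kap2 mnm1E eqxx.
  rewrite mulrC; apply: (cong_mul kap2_add kap2_none); apply: congXB.
  by rewrite /kap2 /zdeg /zwt !mnm1E -!val_eqE.
move: f; apply: hideal_cong_sub => [m|m m' c].
  have [a0|nz _] := eqVneq (m (ix 0)) 0%N; last by apply: adjoin_sub; apply: I1_X.
  rewrite /kap2; case: ifP => // H _; have le4 := zwt_le m.
  (* The monomial is rewritten as y^2 times a z monomial of the same weight, less than the maximal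
     one, and this vanishes modulo x. The classes of degree 3 and weights 1 and 2, which [kap2]
     keeps, are the ones where this fails. *)
  have [||c0 [c1 [c2 [c3 [Hq He]]]]] := @zmon_exists (m (ix 1) + zdeg m - 2)%N (zwt m).
  - by lia.
  - by lia.
  have [Ea Eb Eq Ee _] := monE 0 2 c0 c1 c2 c3.
  rewrite -['X_[m]](subrK 'X_[mon 0 2 c0 c1 c2 c3]); apply: hidealD.
    by apply: I2_same => //; rewrite ?Ea ?Eb ?Eq ?Ee //; lia.
  apply: adjoin_sub; apply/I1E/congX; rewrite /kap1 Ea Eb Eq Ee Hq He /=.
  by case: ifP => //; lia.
rewrite /kap2; case: ifP => // /andP[/eqP a0 _] [Ec].
case: ifP => // /andP[/eqP a0' _] [Ec']; move: Ec'; rewrite -Ec => -[Eq Ee].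
by apply: I2_same.
Qed.

Lemma if_eqSome (T : eqType) (c : bool) (t t' : T) :
  ((if c then Some t else None) == Some t') = c && (t == t').
Proof. by case: c. Qed.

Lemma kap1_eqSome b m n q e : (kap1 b m == Some (n, q, e)) =
  [&& m (ix 0) == 0%N, [|| (n <= 1)%N, e == (4 * q)%N | [&& q == 1%N, e == 1%N & b || (n <= 3)%N]],
      m (ix 1) == n, zdeg m == q & zwt m == e].
Proof.
rewrite /kap1 if_eqSome !xpair_eqE -!andbA; case: eqP => //= _.
apply/andP/andP => -[H /and3P[/eqP E1 /eqP E2 /eqP E3]]; split; rewrite ?E1 ?E2 ?E3 ?eqxx //;
  by move: H; rewrite ?E1 ?E2 ?E3.
Qed.

Lemma kap2_eqSome m q e : (kap2 m == Some (q, e)) =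
  [&& m (ix 0) == 0%N, (4 * q - e <= 8)%N || (4 * q - e <= 11)%N && (e <= 2)%N,
      (m (ix 1) + zdeg m)%N == q & zwt m == e].
Proof.
rewrite /kap2 if_eqSome !xpair_eqE -!andbA; case: eqP => //= _.
apply/andP/andP => -[H /andP[/eqP E1 /eqP E2]]; split; rewrite ?E1 ?E2 ?eqxx //;
  by move: H; rewrite ?E1 ?E2.
Qed.

Lemma zdegU (i : 'I_6) : zdeg U_(i) = (1 < i)%N.
Proof. by case: i => [[|[|[|[|[|[|//]]]]]] lti]; rewrite /zdeg !mnm1E -!val_eqE. Qed.

Lemma zwtU (i : 'I_6) : zwt U_(i) = nth 0%N [:: 0; 0; 0; 1; 3; 4]%N i.
Proof. by case: i => [[|[|[|[|[|[|//]]]]]] lti]; rewrite /zwt !mnm1E -!val_eqE. Qed.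

Lemma mnmU (i j : nat) (lti : (i < 6)%N) (ltj : (j < 6)%N) :
  (U_(Ordinal lti) (Ordinal ltj))%MM = (i == j).
Proof. by rewrite mnm1E. Qed.

Lemma I0_colon b f : I0 b (X 0 * f) -> I0 b f.
Proof.
move=> H [[[p q] t] fl]; rewrite -(H ((p.+1, q, t), fl)) coefsumMX.
apply: eq_coefsum => m _; rewrite /kap0 zdegD zwtD !mnmDE /zdeg /zwt !mnm1E -!val_eqE /=.
by rewrite !add0n.
Qed.

(** Comparing the class sums of y f and z0 f kills those of f, first for y-exponent 0, then 1, then
    the higher ones. The exception is y^3 z1 for [b = false]: modulo x both y and z0 annihilate it,
    since y^4 z1 = x^4 z2, and its degree is 4. *)
Lemma I1_colon b f : (b = false -> exists2 d : nat, (4 < d)%N & f \is d.-homog) ->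
  I1 b ((X 1 - X 2) * f) -> I1 b f.
Proof.
move=> Hf /I1E H; apply/I1E.
pose L n q e g := coefsum (fun m => kap1 b m == Some (n, q, e)) g.
have LX n q e : coefsum (fun m => kap1 b (U_(ix 1) + m)%MM == Some (n, q, e)) f =
    coefsum (fun m => kap1 b (U_(ix 2) + m)%MM == Some (n, q, e)) f.
  by have /eqP := H (n, q, e); rewrite mulrBl linearB /= !coefsumMX subr_eq0 => /eqP.
have L0 q e : L 0%N q e f = 0.
  transitivity (coefsum (fun m => kap1 b (U_(ix 2) + m)%MM == Some (0, q.+1, e)%N) f).
    by apply: eq_coefsum => m _; rewrite !kap1_eqSome zdegD zwtD !mnmDE zdegU zwtU !mnmU /=; lia.
  by rewrite -LX coefsum0P // => m _; rewrite kap1_eqSome zdegD zwtD !mnmDE zdegU zwtU !mnmU /=; lia.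
have L1 q e : L 1%N q e f = 0.
  transitivity (coefsum (fun m => kap1 b (U_(ix 2) + m)%MM == Some (1, q.+1, e)%N) f).
    by apply: eq_coefsum => m _; rewrite !kap1_eqSome zdegD zwtD !mnmDE zdegU zwtU !mnmU /=; lia.
  rewrite -LX -(L0 q.+1 e); apply: eq_coefsum => m _.
  by rewrite !kap1_eqSome zdegD zwtD !mnmDE zdegU zwtU !mnmU /=; lia.
case=> [[[|[|n]] q] e]; [exact: L0|exact: L1|].
have [/andP[/andP[/eqP q1 /eqP e1] /andP[b0 n3]]|ok] :=
    boolP [&& (q == 1%N) && (e == 1%N), ~~ b & (3 <= n.+2)%N].
  have [d lt_d hom_f] := Hf (negbTE b0).
  apply: coefsum0P => m /(dhomogP _ _ _ hom_f)/=; rewrite mdeg6 kap1_eqSome.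
  by move=> Ed; rewrite (negbTE b0) /=; lia.
transitivity (coefsum (fun m => kap1 b (U_(ix 1) + m)%MM == Some (n.+3, q, e)) f).
  apply: eq_coefsum => m _; rewrite !kap1_eqSome zdegD zwtD !mnmDE zdegU zwtU !mnmU /=.
  by move: ok; case: (b) => /=; lia.
rewrite LX coefsum0P // => m _; rewrite kap1_eqSome zdegD zwtD !mnmDE zdegU zwtU !mnmU /=.
by have := zwt_le m; lia.
Qed.

(** Multiplication by z3 preserves [4 * q - e], which alone decides whether a class is zero, except
    in degree 3, where the clause on weights at most 2 keeps two more classes. *)
Lemma I2_colon b d f : (3 < d)%N -> f \is d.-homog -> I2 b (X 5 * f) -> I2 b f.
Proof.
move=> lt_d hom_f /I2E H; apply/I2E => -[q e].
rewrite -(H (q.+1, e + 4)%N) coefsumMX; apply: eq_coefsum => m mf.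
have := dhomogP _ _ _ hom_f m mf; rewrite /= mdeg6 => Ed.
rewrite !kap2_eqSome zdegD zwtD !mnmDE zdegU zwtU !mnmU /=.
by have := zwt_le m; lia.
Qed.

(** In degree at least 4 a nonzero class modulo [I2] has weight at least 8, enough to split off a
    factor z3. *)
Lemma I3_homog b d f : (3 < d)%N -> f \is d.-homog -> I3 b f.
Proof.
move=> lt_d hom_f; rewrite [f]mpolyE big_seq.
elim/big_ind: _ => [|g h|m mf]; [exact: hideal0|exact: hidealD|].
rewrite -mul_mpolyC; apply: hidealM.
have := dhomogP _ _ _ hom_f m mf; rewrite /= mdeg6 => Ed.
case Em : (kap2 m) => [c|]; last first.
  by apply: (adjoin_sub (X_homog (ix 5))); apply/I2E/congX.
move: (Em); rewrite /kap2; case: ifP => // /andP[/eqP a0 H] _; have le4 := zwt_le m.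
have [||c0 [c1 [c2 [c3 [Hq He]]]]] := @zmon_exists (m (ix 1) + zdeg m).-1 (zwt m - 4).
- by lia.
- by lia.
have [Ea Eb Eq Ee _] := monE 0 0 c0 c1 c2 c3.
rewrite -['X_[m]](subrK (X 5 * 'X_[mon 0 0 c0 c1 c2 c3])).
apply: (@hidealD _ _ (I3 b)); last exact: adjoin_mul.
apply: (adjoin_sub (X_homog (ix 5))); rewrite -mpolyXD; apply: I2_same => //; rewrite ?zdegD ?zwtD ?mnmDE ?zdegU ?zwtU ?mnmU /=.
- by rewrite Ea.
- by rewrite Eb Eq Hq; lia.
- by rewrite Ee He; lia.
Qed.

Lemma I3_vanishes b : vanishes_above 3 (I3 b).
Proof.
by apply: vanishes_above_artinian => d f lt_d; apply: I3_homog; rewrite -ltz_nat.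
Qed.

Lemma I2_vanishes b : vanishes_above 3 (I2 b).
Proof.
apply: (vanishes_above_hyperplane _ _ (@I3_vanishes b)) => [|d f lt_d]; first exact: torsionX.
by apply: I2_colon; rewrite -ltz_nat.
Qed.

Lemma vanishes_above_le r r' (I : hideal k 5) : r <= r' -> vanishes_above r I -> vanishes_above r' I.
Proof. by move=> le_r H i j c lt_r'; apply: H; apply: le_lt_trans lt_r'. Qed.

(** The failure of injectivity of y - z0 in degree 4 is what raises the bound from 3 to 4 for
    [b = false]. *)
Lemma I0_vanishes b : vanishes_above (if b then 3 else 4) (I0 b).
Proof.
apply: (vanishes_above_hyperplane (h_homog := X_homog (ix 0))) => [|d f lt_d _|];
  [exact: torsionX|exact: I0_colon|].
apply: (vanishes_above_hyperplane (h_homog := XB_homog (ix 1) (ix 2))) => [|d f lt_d hom_f|].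
- exact: torsionXB.
- by apply: I1_colon => b0; exists d => //; move: lt_d; rewrite b0 ltz_nat.
- by apply: vanishes_above_le (@I2_vanishes b); case: b.
Qed.

End Ideals.

(** * Primality through monomial substitutions *)

Section CongKernel.
Context (k : fieldType) (n n' : nat) (T : eqType) (kap : 'X_{1..n} -> option T).
Variables (lq : n.-tuple {mpoly k[n']}) (code : T -> 'X_{1..n'}).
Hypothesis lqE : forall m,
  'X_[m] \mPo lq = if kap m is Some c then 'X_[code c] else 0.
Hypothesis code_inj : forall m m' c c', kap m = Some c -> kap m' = Some c' ->
  code c = code c' -> c = c'.

(** This is what makes [cong kap] prime, the target being a domain. Distinct classes have distinct
    monomials as images, so different class sums cannot cancel. *)
Lemma cong_kernel (f : {mpoly k[n]}) : cong kap f <-> f \mPo lq = 0.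
Proof.
split.
  apply: (cong_sub (J := fun f => f \mPo lq = 0)) =>
    [|g h Hg Hh|a g Hg|m Hm|m m' c Hm Hm'].
  - by rewrite linear0.
  - by rewrite linearD /= Hg Hh addr0.
  - by rewrite linearZ /= Hg scaler0.
  - by rewrite lqE Hm.
  - by rewrite linearB /= !lqE Hm Hm' subrr.
move=> f0 c; have [/hasP[m0 _ /eqP Em0]|/hasPn nc] :=
  boolP (has (fun m => kap m == Some c) (msupp f)); last exact: coefsum0P.
transitivity ((f \mPo lq)@_(code c)); last by rewrite f0 mcoeff0.
rewrite comp_mpolyEX linear_sum /coefsum big_mkcond; apply: eq_bigr => m _ /=.
rewrite mcoeffZ lqE; case Em : (kap m) => [c'|]; last by rewrite mcoeff0 mulr0.
rewrite mcoeffX; have [E|ne] := eqVneq (code c') (code c).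
  by rewrite (code_inj Em Em0 E) eqxx mulr1.
case: eqP => [[E]|_]; last by rewrite mulr0.
by rewrite E eqxx in ne.
Qed.

Lemma cong_prime (f g : {mpoly k[n]}) : cong kap (f * g) -> cong kap f \/ cong kap g.
Proof.
rewrite !cong_kernel rmorphM => /eqP; rewrite mulf_eq0.
by case/orP=> /eqP; [left|right].
Qed.

End CongKernel.

Lemma cong_notinX (k : fieldType) n (T : eqType) (kap : 'X_{1..n} -> option T) m :
  kap m -> ~ cong kap ('X_[m] : {mpoly k[n]}).
Proof.
case E : (kap m) => [c|//] _ /(_ c); rewrite coefsumX E eqxx => /eqP.
by rewrite oner_eq0.
Qed.

(** * The two closed subschemes and their comparison *)

Section Surface.
Variable k : fieldType.
Local Notation R := {mpoly k[6]}.
Implicit Types (f g : R) (m : 'X_{1..6}).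
Local Notation X i := ('X_(ix i) : R).

Lemma sum6 (F : 'I_6 -> nat) : (\sum_i F i)%N =
  (F (ix 0) + F (ix 1) + F (ix 2) + F (ix 3) + F (ix 4) + F (ix 5))%N.
Proof.
rewrite !big_ord_recl big_ord0.
have E (i j : 'I_6) : val i = val j -> F i = F j by move=> /val_inj ->.
by rewrite addn0 !addnA; do !congr addn; apply: E.
Qed.

Definition param (i : 'I_6) : 'X_{1..3} :=
  [multinom [tuple nth 0%N [:: 1; 1; 0; 0; 0; 0]%N i; nth 0%N [:: 0; 0; 1; 1; 1; 1]%N i;
                   nth 0%N [:: 0; 1; 0; 2; 6; 8]%N i]].

Definition param_code (c : nat * nat * nat * bool) : 'X_{1..3} :=
  [multinom [tuple c.1.1.1; c.1.1.2; c.1.2]].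

Lemma paramE m : 'X_[m] \mPo [tuple 'X_[k, param i] | i < 6] =
  if kap0 false m is Some c then 'X_[param_code c] else 0.
Proof.
rewrite comp_mpolyX (eq_bigr (fun i => 'X_[param i] ^+ m i)); last first.
  by move=> i _; rewrite tnth_mktuple.
rewrite mprodXnE /=; congr 'X_[_]; apply/mnmP => j.
rewrite mnm_sumE (eq_bigr (fun i => param i j * m i)%N) => [|i _]; last by rewrite mulmnE.
rewrite sum6 /zdeg /zwt; case: j => [[|[|[|//]]] ltj];
  rewrite /param_code /param !multinomE !(tnth_nth 0%N) /=; lia.
Qed.

Lemma param_code_inj m m' c c' : kap0 false m = Some c -> kap0 false m' = Some c' ->
  param_code c = param_code c' -> c = c'.
Proof.
move=> [<-] [<-] /mnmP E.
have := E ord0; have := E (Ordinal (isT : 1 < 3)%N); have := E (Ordinal (isT : 2 < 3)%N).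
by rewrite !multinomE !(tnth_nth 0%N) /= => -> -> ->.
Qed.

Lemma I0_prime f g : I0 k false (f * g) -> I0 k false f \/ I0 k false g.
Proof. exact: (@cong_prime k 6 3 _ (kap0 false) _ param_code paramE param_code_inj). Qed.

Lemma I0_point : is_point (I0 k false).
Proof.
split; [|exact: I0_prime|by exists (ix 0); apply: cong_notinX].
by rewrite -mpolyX0; apply: cong_notinX.
Qed.

Lemma I0_saturated b f : (forall i : 'I_6, exists N, I0 k b ('X_i ^+ N * f)) -> I0 k b f.
Proof.
move=> /(_ (ix 0))[N]; elim: N => [|N IH]; first by rewrite mul1r.
by rewrite exprS -mulrA => /I0_colon.
Qed.

Definition surface b : closed_subscheme k 5 := ClosedSubscheme (@I0_saturated b).

(** After multiplication by a z variable the flag no longer separates the two monomials: if both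
    involve z it is off, and if both are free of z it is determined by the variable. *)
Lemma I0_mulz (i : 'I_6) f : (1 < i)%N -> I0 k false f -> I0 k true ('X_i * f).
Proof.
move=> lt_i; move: f; apply: (cong_sub (J := fun f => I0 k true ('X_i * f))).
- by rewrite mulr0; apply: hideal0.
- by move=> f g Hf Hg; rewrite mulrDr; apply: hidealD.
- by move=> a f Hf; rewrite -mul_mpolyC mulrCA; apply: hidealM.
- by [].
move=> m m' c Hm Hm'; rewrite mulrBr -!mpolyXD; apply: congXB.
have {Hm Hm'} : kap0 false m = kap0 false m' by rewrite Hm Hm'.
case=> H1 H2 H3; rewrite /kap0 !zdegD !zwtD !mnmDE.
have zi : zdeg U_(i) = 1%N by rewrite zdegU lt_i.
rewrite zi; congr (Some (_, _, _, _)); [by lia..|].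
by move: H2 H3 zi; rewrite /zdeg /zwt; lia.
Qed.

(** If some z variable is outside [P], it multiplies [f] into the smaller ideal. If all are in [P],
    so is every monomial involving z, and monomials in x and y alone are determined by their
    class. *)
Lemma I0_sub_prime P : is_point P -> (forall f, I0 k true f -> P f) ->
  forall f, I0 k false f -> P f.
Proof.
move=> [_ PM _] PJ f If.
have [[i [lt_i nPi]]|nz] := classic (exists i : 'I_6, (1 < i)%N /\ ~ P 'X_i).
  by have /PJ/PM[] := I0_mulz lt_i If.
have Pz m : zdeg m != 0%N -> P 'X_[m].
  move=> zm; have [i lt_i mi] : exists2 i : 'I_6, (1 < i)%N & m i != 0%N.
    apply: NNPP => H; case/eqP: zm; rewrite /zdeg.
    have z (i : 'I_6) : (1 < i)%N -> m i = 0%N.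
      by move=> lt_i; apply/eqP/negP => /negP ?; apply: H; exists i.
    by rewrite !z.
  rewrite (mpolyX_split k mi) mulrC; apply: hidealM; apply: NNPP => nP.
  by apply: nz; exists i.
move: f If; apply: hideal_cong_sub => // m m' c Hm Hm'.
have {Hm Hm'} [H1 H2 H3] : kap0 false m = kap0 false m' by rewrite Hm Hm'.
have [z0|nz0] := eqVneq (zdeg m) 0%N.
  suff -> : m = m' by rewrite subrr; apply: hideal0.
  by move: z0 H1 H2 H3; rewrite /zdeg /zwt => *; apply: mon_ext; lia.
by apply: hidealB; apply: Pz; rewrite // -H2.
Qed.

Lemma surface_support : same_support (surface false) (surface true).
Proof.
move=> P; split=> -[HP H]; split=> // f; last exact: I0_sub_prime.
by move/I0_sub; apply: H.
Qed.

Definition line_matrix : 'M[k]_(4, 6) := \matrix_(i, j) (j == i.+2 :> nat)%:R.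

Lemma line_matrix_free : row_free line_matrix.
Proof.
apply: inj_row_free => v Hv; apply/rowP => i; rewrite mxE.
have lti : (i.+2 < 6)%N := ltn_ord i.
have := congr1 (fun M : 'rV[k]_6 => M 0 (Ordinal lti)) Hv.
rewrite !mxE (bigD1 i) //= big1 ?addr0 => [|j ji]; first by rewrite !mxE eqxx mulr1.
by rewrite !mxE eqSS eqSS eq_sym val_eqE (negbTE ji) mulr0.
Qed.

Lemma line_matrixE (i : 'I_4) (lti : (i.+2 < 6)%N) :
  \sum_(j < 6) line_matrix i j *: ('X_j : R) = 'X_(Ordinal lti).
Proof.
rewrite (bigD1 (Ordinal lti)) //= big1 ?addr0 => [|j ji]; first by rewrite mxE eqxx scale1r.
by rewrite mxE -[_ == _]/(j == Ordinal lti) (negbTE ji) scale0r.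
Qed.

Lemma surface_coincide : coincide_outside_line (surface false) (surface true).
Proof.
exists line_matrix; first exact: line_matrix_free.
move=> P HP nL u; split=> -[d [g [h [[Hg Ig] Hh nPh ->]]]]; last first.
  by exists d, g, h; split=> //; split=> //; apply: I0_sub.
have [i [lt_i nPi]] : exists i : 'I_6, (1 < i)%N /\ ~ P 'X_i.
  apply: NNPP => H; apply: nL; split=> // i.
  have lti : (i.+2 < 6)%N := ltn_ord i.
  rewrite (line_matrixE lti); apply: NNPP => nP.
  by apply: H; exists (Ordinal lti).
(* Off the line some z variable is outside [P], and it multiplies the numerator into the smaller
   ideal. *)
exists (1 + d)%N, ('X_i * g), ('X_i * h); split.
- by split; [apply: dhomogM => //; apply: X_homog|apply: I0_mulz].
- by apply: dhomogM => //; apply: X_homog.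
- by have [_ PM _] := HP; case/PM.
- by rewrite !rmorphM -mulf_div divff ?mul1r // (point_neq0 nPi).
Qed.

End Surface.

(** * Coordinate subspaces *)

Section CoordinateSubspace.
Context (k : fieldType) (n : nat) (A : pred 'I_n.+1).
Implicit Types (m : 'X_{1..n.+1}).

Definition kapA m : option 'X_{1..n.+1} :=
  if [forall i, A i ==> (m i == 0%N)] then Some m else None.

Lemma kapA_none e m : kapA m = None -> kapA (e + m) = None.
Proof.
rewrite /kapA; case: ifP => // /negbT/forallPn[i]; rewrite negb_imply => /andP[Ai mi] _.
case: ifP => // /forallP/(_ i); rewrite Ai mnmDE addn_eq0 (negbTE mi) andbF //.
Qed.

Lemma kapA_add e m m' : kapA m = kapA m' -> kapA (e + m) = kapA (e + m').
Proof.
case Em : (kapA m) => [c|] Em'; last by rewrite !kapA_none.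
move: Em Em'; rewrite /kapA; case: ifP => // _ [<-]; case: ifP => // _ [<-] //.
Qed.

Lemma kapA_deg m m' c : kapA m = Some c -> kapA m' = Some c -> mdeg m = mdeg m'.
Proof. by rewrite /kapA; case: ifP => // _ [->]; case: ifP => // _ [->]. Qed.

Definition coord_ideal : hideal k n := cong_hideal k kapA_add kapA_none kapA_deg.

Lemma kapA_kernel m : 'X_[m] \mPo [tuple if A i then 0 else 'X_i : {mpoly k[n.+1]} | i < n.+1] =
  if kapA m is Some c then 'X_[c] else 0.
Proof.
rewrite comp_mpolyX /kapA; case: ifP => [/forallP H|/negbT/forallPn[i]].
  rewrite mpolyXE_id; apply: eq_bigr => i _; rewrite tnth_mktuple.
  by have := H i; case: (A i) => //= /eqP->.
rewrite negb_imply => /andP[Ai mi].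
by rewrite (bigD1 i) //= tnth_mktuple Ai expr0n (negbTE mi) mul0r.
Qed.

Lemma coord_point i : ~~ A i -> is_point coord_ideal.
Proof.
move=> nAi; split=> [|f g|].
- rewrite -mpolyX0; apply: cong_notinX; rewrite /kapA; case: ifP => // /negbT/forallPn[j].
  by rewrite mnm0E eqxx implybT.
- exact: (@cong_prime k _ _ _ kapA _ id kapA_kernel).
exists i; apply: cong_notinX; rewrite /kapA; case: ifP => // /negbT/forallPn[j].
by rewrite mnm1E; case: (eqVneq i j) => [<-|_]; rewrite ?(negbTE nAi) ?implybT.
Qed.

Lemma coord_X i : A i -> coord_ideal 'X_i.
Proof.
by move=> Ai; apply: congX; rewrite /kapA; case: ifP => // /forallP/(_ i); rewrite Ai mnm1E eqxx.
Qed.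

Lemma coord_notinX i : ~~ A i -> ~ coord_ideal 'X_i.
Proof.
move=> nAi; apply: cong_notinX; rewrite /kapA; case: ifP => // /negbT/forallPn[j].
by rewrite mnm1E; case: (eqVneq i j) => [<-|_]; rewrite ?(negbTE nAi) ?implybT.
Qed.

End CoordinateSubspace.

Lemma coord_sub (k : fieldType) n (A B : pred 'I_n.+1) : subpred A B ->
  forall f, coord_ideal k A f -> coord_ideal k B f.
Proof.
move=> sAB f.
have none m : kapA A m = None -> kapA B m = None.
  rewrite /kapA; case: ifP => // /negbT/forallPn[i]; rewrite negb_imply => /andP[/sAB Bi mi] _.
  by case: ifP => // /forallP/(_ i); rewrite Bi (negbTE mi).
apply: cong_transfer => // m m' E; case Em : (kapA A m) => [c|]; last first.
  by rewrite !none // -E.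
move: Em (E); rewrite /kapA; case: ifP => // _ _; case: ifP => // _ [-> //].
Qed.

(** * Dimension of the surface *)

Section Dimension.
Variable k : fieldType.
Local Notation line := (coord_ideal k (fun i : 'I_6 => (1 < i)%N)).
Local Notation pt := (coord_ideal k (fun i : 'I_6 => (0 < i)%N)).

Lemma I0_sub_line f : I0 k false f -> line f.
Proof.
apply: cong_transfer => // m m'; case=> H1 H2 H3.
have sm (m1 : 'X_{1..6}) :
    [forall i, ((fun i : 'I_6 => (1 < i)%N) i) ==> (m1 i == 0%N)] = (zdeg m1 == 0%N).
  apply/forallP/eqP => [H|H i].
    have z (i : 'I_6) : (1 < i)%N -> m1 i = 0%N by move=> lt_i; apply/eqP; have := H i; rewrite lt_i.
    by rewrite /zdeg !z.
  by apply/implyP; case: i => [[|[|[|[|[|[|//]]]]]] lti] // _; move: H; rewrite /zdeg;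
    rewrite (bool_irrelevance lti isT); lia.
rewrite /kapA !sm -H2; case: ifP => // /eqP z0; congr Some.
by move: z0 H1 H2 H3; rewrite /zdeg /zwt => *; apply: mon_ext; lia.
Qed.

Lemma line_neq : ~ sub_points (V (I0 k false)) (V line).
Proof.
move=> /(_ (I0 k false))[]; first by split=> //; apply: I0_point.
move=> _ H; have : I0 k false 'X_(ix 2) by apply: H; apply: coord_X.
exact: cong_notinX.
Qed.

Lemma V_sub (I J : hideal k 5) : (forall f, J f -> I f) -> sub_points (V I) (V J).
Proof. by move=> H P [HP IP]; split=> // f /H /IP. Qed.

Lemma surface_dim_ge2 : exists Z, irreducible_chain (I0 k false) 2 Z.
Proof.
pose Z i := match i with 0 => pt | 1 => line | _ => I0 k false end%N.
have ptP : is_point pt by apply: (@coord_point _ _ _ (ix 0)).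
have lineP : is_point line by apply: (@coord_point _ _ _ (ix 1)).
have line_pt f : line f -> pt f by apply: coord_sub => i /ltnW.
exists Z; split=> [[|[|[|//]]] _|[|[|//]] _] /=.
- by split; [exact: point_irreducible|apply: V_sub => f /I0_sub_line/line_pt].
- by split; [exact: point_irreducible|apply: V_sub => f /I0_sub_line].
- by split; [apply/point_irreducible/I0_point|].
- split; first exact: V_sub.
  move=> /(_ line)[]; first by split.
  move=> _ H; have : line 'X_(ix 1) by apply: H; apply: coord_X.
  exact: coord_notinX.
- by split; [apply: V_sub => f /I0_sub_line|exact: line_neq].
Qed.

(** Polynomials of degree at most [M] involve at most (M + 1)^2 (8 M + 1) classes, a cubic bound,
    against the [N ^ e.+1] independent elements provided by a chain. *)
Lemma surface_dim_le2 e Z : irreducible_chain (I0 k false) e Z -> (e <= 2)%N.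
Proof.
move=> /chain_growth[D HD]; rewrite leqNgt; apply/negP => lt_e.
(* One more than the constant in front of [N ^ 3] in the count for [M = D * N]. *)
pose N := ((D.+1 * D.+1 * (8 * D).+1).+1)%N.
have [T [w [cT fr deg_w]]] := HD N.
pose M := (D * N)%N; pose C := ('I_M.+1 * 'I_M.+1 * 'I_(8 * M).+1)%type.
have := @free_mod_card k 5 _ (kap0 false) T C w
  (fun c => (c.1.1 : nat, c.1.2 : nat, c.2 : nat, false)) _ fr.
rewrite cT !card_prod !card_ord => le_card.
have {le_card} : (N ^ e.+1 <= M.+1 * M.+1 * (8 * M).+1)%N.
  apply: le_card => t m /(deg_w t); rewrite mdeg6 => le_m; have le4 := zwt_le m.
  have lep : (m (ix 0) + m (ix 1) < M.+1)%N by lia.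
  have leq : (zdeg m < M.+1)%N by lia.
  have let_ : (m (ix 1) + 2 * zwt m < (8 * M).+1)%N by lia.
  by exists (Ordinal lep, Ordinal leq, Ordinal let_).
apply/negP; rewrite -ltnNge.
have le1 : (M.+1 <= D.+1 * N)%N by rewrite /M mulSn -addn1 addnC leq_add2r.
have le8 : ((8 * M).+1 <= (8 * D).+1 * N)%N by rewrite [leqRHS]mulSn -mulnA -[leqLHS]add1n leq_add2r.
apply: (leq_ltn_trans (leq_mul (leq_mul le1 le1) le8)).
have -> : (D.+1 * N * (D.+1 * N) * ((8 * D).+1 * N) = (D.+1 * D.+1 * (8 * D).+1) * N ^ 3)%N.
  by rewrite !expnS expn0 muln1; ring.
apply: (@leq_trans (N ^ 4)%N); last by rewrite leq_exp2l.
by rewrite [(N ^ 4)%N]expnS ltn_mul2r expn_gt0 ltnSn.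
Qed.

End Dimension.

Section FractionIdentities.
Variable K : fieldType.
Implicit Types x y : K.

Lemma frac_sub2 x y (a b : K) : x != 0 -> y != 0 ->
  (-1) ^+ 0 * (b / y) + (-1) ^+ 1 * (a / x) = (x * b - y * a) / (x * y).
Proof. by move=> x0 y0; field; rewrite x0 y0. Qed.

Lemma frac_clear x y (a b c : K) : x != 0 -> y != 0 ->
  a / x - b = c / y -> y * (a - x * b) = x * c.
Proof.
move=> x0 y0 E; rewrite -[c](divfK y0) -E; field; exact: x0.
Qed.

Lemma frac_clear2 x y (s s' a b b' c : K) : x != 0 -> y != 0 ->
  a / (x * y) - (s * (b / y) + s' * (b' / x)) = c / (x * y) ->
  a - (s * (x * b) + s' * (y * b')) = c.
Proof.
move=> x0 y0 E; have xy0 : x * y != 0 by rewrite mulf_neq0.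
by rewrite -[c](divfK xy0) -E; field; rewrite x0 y0.
Qed.

End FractionIdentities.

(** * Depth and regularity of the two schemes *)

Section Invariants.
Variable k : fieldType.
Local Notation R := {mpoly k[6]}.
Implicit Types (f g : R) (m : 'X_{1..6}).
Local Notation X i := ('X_(ix i) : R).

Lemma coefsum1 (P : pred 'X_{1..6}) m : P m -> coefsum P ('X_[m] : R) = 1.
Proof. by move=> Pm; rewrite coefsumX Pm. Qed.

(* X_i g for the element g = u^2 v t^5 that the parametrized ring misses. *)
Definition socleS (i : 'I_6) : 'X_{1..6} :=
  nth 0%MM [:: mon 0 3 0 1 0 0; mon 3 0 0 0 1 0; mon 1 1 0 2 0 0;
               mon 1 1 1 0 1 0; mon 1 1 0 1 0 1; mon 1 1 0 0 2 0] i.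

(* X_i h, i > 0, for the element h = u v t^5 that the parametrized ring misses. *)
Definition socleJ (i : 'I_6) : 'X_{1..6} :=
  nth 0%MM [:: 0%MM; mon 2 0 0 0 1 0; mon 0 1 0 2 0 0;
               mon 0 1 1 0 1 0; mon 0 1 0 1 0 1; mon 0 1 0 0 2 0] i.

Lemma ord6P (Q : 'I_6 -> Prop) :
  Q (ix 0) -> Q (ix 1) -> Q (ix 2) -> Q (ix 3) -> Q (ix 4) -> Q (ix 5) -> forall i, Q i.
Proof.
by move=> ? ? ? ? ? ? [[|[|[|[|[|[|//]]]]]] lti]; rewrite (bool_irrelevance lti isT).
Qed.

Lemma socleSE i : [/\ (socleS i (ix 0) + socleS i (ix 1) = U_(i)%MM (ix 0) + U_(i)%MM (ix 1) + 2)%N,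
  (zdeg (socleS i) = zdeg U_(i) + 1)%N &
  (socleS i (ix 1) + 2 * zwt (socleS i) = U_(i)%MM (ix 1) + 2 * zwt U_(i) + 5)%N].
Proof. by move: i; apply: ord6P; rewrite zdegU zwtU !mnmU. Qed.

Lemma socleJE (i : 'I_6) : (0 < i)%N ->
  [/\ (socleJ i (ix 0) + socleJ i (ix 1) = U_(i)%MM (ix 0) + U_(i)%MM (ix 1) + 1)%N,
  (zdeg (socleJ i) = zdeg U_(i) + 1)%N &
  (socleJ i (ix 1) + 2 * zwt (socleJ i) = U_(i)%MM (ix 1) + 2 * zwt U_(i) + 5)%N].
Proof. by move: i; apply: ord6P => // _; rewrite zdegU ?zwtU ?mnmU. Qed.

Lemma socleS_cocycle (i j : 'I_6) :
  I0 k false ('X_i * 'X_[socleS j] - 'X_j * 'X_[socleS i]).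
Proof.
rewrite -!mpolyXD; apply: congXB; rewrite /kap0 !zdegD !zwtD !mnmDE.
have [H1 H2 H3] := socleSE i; have [H1' H2' H3'] := socleSE j.
by congr (Some (_, _, _, _)); lia.
Qed.

(** If x m is in the class of x g, then m is a monomial for g = u^2 v t^5; its y-exponent would be 1
    and its weight the missing 2. *)
Lemma socleS_neq0 f : ~ I0 k false ('X_[socleS (ix 0)] - X 0 * f).
Proof.
move=> /(_ (3, 1, 5, false)%N); rewrite linearB /= coefsum1 // coefsumMX coefsum0P.
  by move/eqP; rewrite subr0 oner_eq0.
move=> m _; rewrite /kap0 zdegD zwtD !mnmDE zdegU zwtU !mnmU /=.
apply/negP => /eqP[H1 H2 H3]; have := zwt_le m; have := @zwt_zdeg1 m; lia.
Qed.

(** For distinct indices at least one variable is a z, so both products have degree at least 2 in z;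
    the flag is off, and both represent X_i X_j h. *)
Lemma socleJ_cocycle (i j : 'I_6) : i != ix 0 -> j != ix 0 ->
  I0 k true ('X_i * 'X_[socleJ j] - 'X_j * 'X_[socleJ i]).
Proof.
rewrite -!val_eqE /= -!lt0n => i0 j0.
have [->|ij] := eqVneq i j; first by rewrite subrr; apply: cong0.
rewrite -!mpolyXD; apply: congXB; rewrite /kap0 !zdegD !zwtD !mnmDE.
have [H1 H2 H3] := socleJE i0; have [H1' H2' H3'] := socleJE j0.
have {ij} : (0 < zdeg U_(i) + zdeg U_(j))%N.
  rewrite !zdegU lt0n addn_eq0 !eqb0 -!leqNgt; apply: contraNN ij => /andP[i1 j1].
  by rewrite -val_eqE eqn_leq (leq_trans i1 j0) (leq_trans j1 i0).
by move=> H; congr (Some (_, _, _, _)); lia.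
Qed.

(** A multiple of x in the class of z0 h would have no y, which the odd power t^5 forbids. A
    multiple of z0 would leave a monomial for u v t^5, of y-exponent 1 and weight 2 in degree
    one. *)
Lemma socleJ_neq0 f g : ~ I0 k true ('X_[socleJ (ix 2)] - (X 0 * f - X 2 * g)).
Proof.
move=> /(_ (1, 2, 5, false)%N); rewrite !linearB /= coefsum1 // !coefsumMX !coefsum0P.
- by move/eqP; rewrite !subr0 oner_eq0.
- move=> m _; rewrite /kap0 zdegD zwtD !mnmDE zdegU zwtU !mnmU /=.
  apply/negP => /eqP[H1 H2 H3 _]; have := zwt_le m; have := @zwt_zdeg1 m; lia.
- move=> m _; rewrite /kap0 zdegD zwtD !mnmDE zdegU zwtU !mnmU /=.
  apply/negP => /eqP[H1 H2 H3 _]; lia.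
Qed.

Lemma I0_colonX b N f : I0 k b (X 0 ^+ N * f) -> I0 k b f.
Proof.
elim: N => [|N IH]; first by rewrite mul1r.
by rewrite exprS -mulrA => /I0_colon.
Qed.

Lemma max_idealX (i : 'I_6) : max_ideal ('X_i : R).
Proof.
exists (fun j => (j == i)%:R); rewrite (bigD1 i) //= eqxx mul1r big1 ?addr0 // => j ji.
by rewrite (negbTE ji) mul0r.
Qed.

Lemma max_idealB f g : max_ideal f -> max_ideal g -> max_ideal (f - g).
Proof.
move=> [a ->] [b ->]; exists (fun i => a i - b i); rewrite -sumrB.
by apply: eq_bigr => i _; rewrite mulrBl.
Qed.

Lemma adjoinE (I : hideal k 5) h (hh : h \is 1.-homog) f :
  adjoin I hh f <-> exists a, I (f - a * h).
Proof.
split=> [[g Ig [a ->]]|[a Ia]]; first by exists a; rewrite [a * h]mulrC addrK.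
by exists (f - a * h) => //; exists a; rewrite [h * a]mulrC subrK.
Qed.

Lemma surface_depth : is_depth (I0 k false) 1.
Proof.
split=> [|s]; last first.
  apply: (@depth_le1 _ _ _ (fun i => 'X_[socleS i])); first exact: socleS_cocycle.
  by move=> f; exists (ix 0); apply: socleS_neq0.
exists [:: X 0]; split=> //=; split; [exact: max_idealX|exact: I0_colon|].
move=> H; have : I1 k false 1 by apply/(adjoinE _ (X_homog k (ix 0))).
by move/I1E; rewrite -mpolyX0; apply: cong_notinX; rewrite /kap1 /zdeg /zwt !mnm0E.
Qed.

Lemma nonreduced_depth : is_depth (I0 k true) 2.
Proof.
split=> [|s]; last first.
  apply: (@depth_le2 _ _ _ (ix 0) (fun i => 'X_[socleJ i])); first exact: socleJ_cocycle.
  by move=> f; exists (ix 2) => //; apply: socleJ_neq0.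
exists [:: X 0; X 1 - X 2]; split=> //=; split; [exact: max_idealX|exact: I0_colon|].
have E f := iff_sym (adjoinE (I0 k true) (X_homog k (ix 0)) f).
split; first by apply: max_idealB; apply: max_idealX.
  by move=> g /E/I1_colon H; apply/E/H.
move=> [a /E Ha]; have : I2 k true 1 by apply/(adjoinE _ (XB_homog k _ _)); exists a.
by move/I2E; rewrite -mpolyX0; apply: cong_notinX; rewrite /kap2 /zdeg /zwt !mnm0E.
Qed.

Lemma vanishes_above_bound (I : hideal k 5) r i j :
  vanishes_above r I -> local_cohomology_neq0 I i j -> i%:Z + j <= r.
Proof.
move=> van /local_cohomology_neq0P[c Hc nb]; rewrite leNgt; apply/negP => lt_r.
exact/nb/van.
Qed.

(** One passes to a nonzero class of larger [i + j] as long as there is one; the bound [r] makes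
    this stop. *)
Lemma is_reg_exists (I : hideal k 5) r i j : vanishes_above r I ->
  local_cohomology_neq0 I i j -> exists2 r', is_reg I r' & r' <= r.
Proof.
move=> van H; have le_r := vanishes_above_bound van H.
have [d Ed] : exists d : nat, i%:Z + j = r - d%:Z by exists (`|(r - (i%:Z + j))%R|)%N; lia.
elim/ltn_ind: d i j {le_r} Ed H => d IH i j Ed H.
have [[i' [j' [lt_j H']]]|nex] :=
    classic (exists i' j', i%:Z + j < i'%:Z + j' /\ local_cohomology_neq0 I i' j').
  have le_r' := vanishes_above_bound van H'.
  apply: (IH `|(r - (i'%:Z + j'))%R|%N _ i' j') => //; lia.
exists (i%:Z + j); last by lia.
split=> [|i' j' H']; first by exists i, j.
by rewrite leNgt; apply/negP => lt_j; apply: nex; exists i', j'.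
Qed.

(** The class of g, written (X_i g) / X_i on each chart. Were it a coboundary, g would agree with a
    polynomial, against [socleS_neq0]. *)
Lemma surface_cohomology : local_cohomology_neq0 (I0 k false) 1 3%:Z.
Proof.
pose c (S : {set 'I_6}) : {fraction R} :=
  if [pick i in S] is Some i then tofrac 'X_[socleS i] / tofrac 'X_i else 0.
have cE i : c [set i] = tofrac 'X_[socleS i] / tofrac (xprod k [set i]).
  rewrite /c /xprod big_set1; case: pickP => [j|/(_ i)]; last by rewrite !inE eqxx.
  by rewrite inE => /eqP->.
have X0 (i : 'I_6) : tofrac ('X_i : R) != 0 by rewrite tofrac_eq0 -msize_poly_eq0 msizeX.
exists c; split=> [S /eqP/cards1P[i ->]|T HT|[b [Hb Hd]]].
- exists 1%N, 'X_[socleS i]; rewrite cE expr1 cards1; split=> // m.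
  rewrite msuppX inE => /eqP->; move: i; apply: ord6P; rewrite mdeg6 //.
- have [i [j [lt_ij ->]]] : exists i j : 'I_6, (i < j)%N /\ T = [set i; j].
    have /cards2P[i [j [ij ->]]] : #|T| == 2%N by rewrite HT.
    case: (ltngtP i j) => [lt|lt|/val_inj E]; first by exists i, j.
      by exists j, i; rewrite setUC.
    by rewrite E eqxx in ij.
  have ij : i != j by rewrite -val_eqE neq_ltn lt_ij.
  exists 1%N, ('X_i * 'X_[socleS j] - 'X_j * 'X_[socleS i]); split; first exact: socleS_cocycle.
  have Ej : [set i; j] :\ i = [set j] by rewrite setU1K ?inE.
  have Ei : [set i; j] :\ j = [set i] by rewrite setUC setU1K ?inE // eq_sym.
  rewrite /cech_diff big_setU1 ?inE //= big_set1 Ei Ej !cE /xprod big_setU1 ?inE //= !big_set1.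
  have -> : [set s in [set i; j] | (s < i)%N] = set0.
    apply/setP => s; rewrite !inE; case: eqP => [->|_]; first by rewrite ltnn.
    by case: eqP => [->|_] //=; rewrite ltnNge ltnW.
  have -> : [set s in [set i; j] | (s < j)%N] = [set i].
    apply/setP => s; rewrite !inE; case: eqP => [->|_] //=.
    by case: eqP => [->|_] //=; rewrite ltnn.
  by rewrite cards0 cards1 expr1 rmorphM rmorphB !rmorphM frac_sub2.
have [|N [f [_ Ef]]] := Hb set0; first by rewrite cards0.
have [M [h [Ih Eh]]] := Hd [set ix 0] (cards1 _).
move: Eh; rewrite /cech_diff big_set1 setDv cE Ef.
have -> : [set s in [set ix 0] | (s < ix 0)%N] = set0 by apply/setP => s; rewrite !inE andbF.
rewrite /xprod big_set0 big_set1 rmorph1 expr1n divr1 cards0 expr0 mul1r.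
move/(frac_clear (X0 _) (expf_neq0 _ (X0 _))).
rewrite -rmorphXn -!rmorphM -rmorphB -rmorphM => /eqP; rewrite tofrac_eq => /eqP E.
apply: (@socleS_neq0 f); apply: (@I0_colonX _ M); rewrite E.
exact: hidealM.
Qed.

Lemma zdegMn m K : zdeg (m *+ K) = (zdeg m * K)%N.
Proof. by rewrite /zdeg !mulmnE -!mulnDl. Qed.

Lemma zwtMn m K : zwt (m *+ K) = (zwt m * K)%N.
Proof. by rewrite /zwt !mulmnE !mulnA -!mulnDl. Qed.

(** It supplies the nonzero class asked for by [is_reg_exists]. The cochain G / (x y)^7, of degree 5
    - 14, is a cocycle because every z variable multiplies [G] into the ideal. *)
Lemma nonreduced_cohomology : local_cohomology_neq0 (I0 k true) 2 (- 9%:Z).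
Proof.
pose G : R := 'X_[mon 0 4 0 1 0 0] - 'X_[mon 4 0 0 0 1 0].
have IG : I0 k false G by apply: congXB.
pose S2 : {set 'I_6} := [set ix 0; ix 1].
pose c (S : {set 'I_6}) : {fraction R} := if S == S2 then tofrac G / tofrac (xprod k S2) ^+ 7 else 0.
have card2 : #|S2| = 2%N by rewrite cards2.
exists c; split=> [S HS|T HT|[b [Hb Hd]]].
- rewrite /c; case: eqP => [->|_]; last exact: loc_deg0.
  exists 7%N, G; split=> // m /msuppB_le; rewrite mem_cat !msuppX !inE card2.
  by case/orP=> /eqP->; rewrite mdeg6.
- rewrite /cech_diff; elim/big_ind: _ => [|u v|t tT]; [exact: loc_ideal0|exact: loc_idealD|].
  apply: loc_ideal_sign; rewrite /c; case: eqP => [E|_]; last exact: loc_ideal0.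
  have lt_t : (1 < t)%N.
    have : t \notin S2 by rewrite -E !inE eqxx.
    by rewrite !inE -!val_eqE /=; case: t {tT E} => [[|[|t]]].
  exists 7%N, ('X_t ^+ 7 * G); split.
    by rewrite exprSr -mulrA; apply: hidealM; apply: I0_mulz.
  have Et : xprod k [set t] = 'X_t by rewrite /xprod big_set1.
  by rewrite -E (xprodD1 k tT) -Et frac_cancel.
have [N0 H0] := loc_degP (Hb [set ix 0] (congr1 S (cards1 _))).
have [N1 H1] := loc_degP (Hb [set ix 1] (congr1 S (cards1 _))).
have [N2 H2] := loc_idealP (Hd S2 card2).
pose K := (7 + N0 + N1 + N2)%N.
have [f [_ Ef]] := H0 K ltac:(rewrite /K; lia).
have [g [_ Eg]] := H1 K ltac:(rewrite /K; lia).
have [h [Ih Eh]] := H2 K ltac:(rewrite /K; lia).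
have E01 : ix 0 != ix 1 by [].
have K7 : (7 <= K)%N by rewrite /K -!addnA leq_addr.
move: K {H0 H1 H2} K7 f g h Ef Eg Ih Eh => {N0 N1 N2} K K7 f g h Ef Eg Ih Eh.
have EK : K = ((K - 7) + 7)%N by rewrite subnK.
have x0 : tofrac (xprod k [set ix 0]) ^+ K != 0 := xprodX_neq0 _ _ _.
have x1 : tofrac (xprod k [set ix 1]) ^+ K != 0 := xprodX_neq0 _ _ _.
have E2 : tofrac (xprod k S2) ^+ K =
    tofrac (xprod k [set ix 0]) ^+ K * tofrac (xprod k [set ix 1]) ^+ K.
  by rewrite /xprod big_setU1 ?inE //= !big_set1 rmorphM exprMn.
have ES0 : S2 :\ ix 0 = [set ix 1] by rewrite setU1K ?inE.
have ES1 : S2 :\ ix 1 = [set ix 0] by rewrite /S2 setUC setU1K ?inE.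
move: Eh; rewrite /cech_diff {1}/c eqxx -(frac_shift _ _ (K - 7)) -EK big_setU1 ?inE //= big_set1.
rewrite -/S2 ES0 ES1 Ef Eg !E2 => /(frac_clear2 x0 x1).
set s := #|_|; set s' := #|_| => {}Eh.
have E : xprod k S2 ^+ (K - 7) * G - ((-1) ^+ s * (xprod k [set ix 0] ^+ K * g) +
    (-1) ^+ s' * (xprod k [set ix 1] ^+ K * f)) = h.
  apply/eqP; rewrite -tofrac_eq -Eh rmorphB rmorphD; apply/eqP.
  congr (_ - (_ + _)).
    by rewrite rmorphM rmorphXn rmorphN1 rmorphM rmorphXn.
  by rewrite rmorphM rmorphXn rmorphN1 rmorphM rmorphXn.
(* The class of (x y)^(K - 7) y^4 z1. Its flag excludes the other term of [G]. Its monomials have x-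
   and y-exponents below [K], the extreme one being x^(K - 9) y^(K - 1) z0, so multiples of x^K and
   y^K do not meet it; the exponent 7 is just large enough for this. *)
have := Ih (K + K - 10, 1, K - 1, true)%N; rewrite -E linearB linearD /=.
rewrite /xprod big_setU1 ?inE //= !big_set1 ![(-1) ^+ _ * _]mulrCA -mpolyXD !mpolyXn.
rewrite (coefsumMX0 (e := (U_(ix 0) *+ K)%MM)); last first.
  move=> m; rewrite /kap0 zdegD zwtD !mnmDE zdegMn zwtMn !mulmnE zdegU zwtU !mnmU /=.
  by apply/negP => /eqP[H1 H2 H3]; rewrite /zdeg /zwt in H2 H3 *; lia.
rewrite (coefsumMX0 (e := (U_(ix 1) *+ K)%MM)); last first.
  move=> m; rewrite /kap0 zdegD zwtD !mnmDE zdegMn zwtMn !mulmnE zdegU zwtU !mnmU /=.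
  by apply/negP => /eqP[H1 H2 H3]; lia.
rewrite addr0 subr0 mulrBr linearB /= -!mpolyXD coefsum1.
  rewrite coefsumX; case: eqP => [[_ _ _]|_]; last by move/eqP; rewrite subr0 oner_eq0.
  move=> + _; rewrite !(mnmDE, mulmnE, mnmU) /=.
  by have [_ _ _ _] := monE 4 0 0 0 1 0; lia.
rewrite /kap0 !(zdegD, zwtD, zdegMn, zwtMn, mnmDE, mulmnE, zdegU, zwtU, mnmU) /=.
have [-> -> -> -> E23] := monE 0 4 0 1 0 0.
by apply/eqP; congr (Some (_, _, _, _)); lia.
Qed.

Lemma surface_reg : is_reg (I0 k false) 4.
Proof.
split=> [|i j]; first by exists 1%N, 3%:Z; split=> //; apply: surface_cohomology.
exact/vanishes_above_bound/(@I0_vanishes k false).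
Qed.

Lemma nonreduced_reg : exists2 r, is_reg (I0 k true) r & r < 4.
Proof.
have [r Hr le_r] := is_reg_exists (@I0_vanishes k true) nonreduced_cohomology.
by exists r => //; apply: le_lt_trans le_r _.
Qed.

End Invariants.

Theorem proposition1p3 (k : fieldType) :
  exists S S' : closed_subscheme k 5,
    [/\ irreducible_closed S, reduced S & has_dim S 2] /\
    same_support S S' /\
    coincide_outside_line S S' /\
    (exists r r' : int, [/\ is_reg S r, is_reg S' r' & r' < r]) /\
    (exists d d' : nat, [/\ is_depth S d, is_depth S' d' & (d < d')%N]).
Proof.
exists (surface k false), (surface k true).
split; last split; last split; last split.
- split; [exact/point_irreducible/I0_point|exact/point_reduced/I0_point|].
  by split; [exact: surface_dim_ge2|exact: surface_dim_le2].
- exact: surface_support.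
- exact: surface_coincide.
- have [r Hr lt_r] := nonreduced_reg k; exists 4, r; split=> //.
  exact: surface_reg.
- by exists 1%N, 2%N; split; [exact: surface_depth|exact: nonreduced_depth|].
Qed.
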